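(* Let $G$ be a finite group and $p$ a prime, let $N\trianglelefteq G$ and let $\theta\in\mathrm{Irr}(N)$ be $G$-invariant. Let $P$ be a Sylow $p$-subgroup of $G$ and assume that $\theta$ extends to $NP$. Then the following are equivalent. (i) Every $\chi\in\mathrm{Irr}_{p',\mathrm{rel}}(N\mathbf N_G(P)|\theta)$ extends to $G$. (ii) Every $\chi\in\mathrm{Irr}(N\mathbf N_G(P)|\theta)$ extends to $G$. (iii) There is a normal complement $K/N$ to $\mathbf N_G(P)N/N$ in $G/N$ such that $\theta$ has an extension $\hat\theta\in\mathrm{Irr}(K)$. (iv) There is a normal complement $K/N$ to $\mathbf N_G(P)N/N$ in $G/N$ such that $\theta$ has a $G$-invariant extension $\hat\theta\in\mathrm{Irr}(K)$.
   Context: Characters are complex. For $N\trianglelefteq H$ and $\theta\in\mathrm{Irr}(N)$, $\mathrm{Irr}(H|\theta)$ is the set of irreducible characters of $H$ whose restriction to $N$ contains $\theta$. If $\theta$ is $H$-invariant, $\mathrm{Irr}_{p',\mathrm{rel}}(H|\theta)$ is the set of $\chi\in\mathrm{Irr}(H|\theta)$ such that $p$ does not divide $\chi(1)/\theta(1)$. A character of a subgroup extends to a larger group if it is the restriction of a character of that group. A normal complement $K/N$ to $\mathbf N_G(P)N/N$ in $G/N$ is a normal subgroup $K/N\trianglelefteq G/N$ with $K\mathbf N_G(P)=G$ and $K\cap N\mathbf N_G(P)=N$. *)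

(* Defs.v *)
From mathcomp Require Import all_boot all_order all_algebra.
From mathcomp Require Import all_fingroup all_solvable all_field all_character.

Set Implicit Arguments.
Unset Strict Implicit.
Unset Printing Implicit Defensive.

Import Order.TTheory GroupScope GRing.Theory Num.Theory.
Local Open Scope ring_scope.

Section Defs.

Variable gT : finGroupType.
Implicit Types G H K N P : {group gT}.

Definition char_extends H G (phi : 'CF(H)) : Prop :=
  H \subset G /\
  exists2 psi : 'CF(G), psi \is a character & 'Res[H] psi = phi.

Definition irr_over N H (t : Iirr N) : {set Iirr H} :=
  [set i | t \in irr_constt ('Res[N] 'chi_i)].

(* The degree ratio is computed in algC, and (_ %| _)%C is divisibility with *)
(* quotient in the rational integers. The ratio is itself a natural number   *)
(* when N is normal in H and 'chi_t is H-invariant, the only case intended.  *)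
Definition irr_rel_pprime (p : nat) N H (t : Iirr N) : {set Iirr H} :=
  [set i in irr_over H t | ~~ (p%:R %| 'chi_i 1%g / 'chi_t 1%g)%C].

(* K, with N <= K <= G, represents the normal subgroup K / N of G / N. *)
Definition normal_complement G N P K : Prop :=
  [/\ N \subset K, K \subset G, K / N <| G / N,
      (K * 'N_G(P))%g = G & K :&: (N * 'N_G(P))%g = N].

End Defs.

Arguments irr_over {gT N} H t.
Arguments irr_rel_pprime {gT} p {N} H t.

(* Main.v *)
Require Import Defs.
From mathcomp Require Import all_boot all_order all_algebra.
From mathcomp Require Import all_fingroup all_solvable all_field all_character.

(** Write H = N N_G(P) and R = NP; R / N is a Sylow p-subgroup of G / N and
    H / N is its normalizer, by the Frattini argument.

    From extensions to a complement.  A character S of G whose restriction to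
    N is a multiple e theta of theta has a relative kernel: a normal subgroup
    L >= N of G such that a subgroup T >= N lies in L exactly when S restricts
    to T as e times a single extension of theta ([relative_kernel],
    [extension_of_norm]).  It is the kernel of the G / N-character carried by
    the N-fixed part of S S^*, so it stands in for kernels of characters of
    G / N although theta need not extend to G.  For S take sums of extensions
    to G of characters of relative p'-degree of H.  First, theta has an
    H-invariant extension eta to R ([invariant_extension]); summing over the
    characters lying over eta gives L with L n H = R ([norm_Res_irr_over],
    [kernel_rel_over_sub]).  Summing over all of them gives K such that K n R
    is the inverse image of the derived subgroup of R / N
    ([norm_Res_rel_der1], [kernel_rel_der1]).

    Now compute in G / N.  The Sylow subgroup R / N of L / N is its own
    normalizer there, and becomes abelian modulo M = (L n K) / N.  Burnside's
    transfer argument shows that the subgroup X generated by the p'-elements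
    of L / N meets R / N inside M, hence inside the derived subgroup of R / N
    ([Burnside_presidual]); a character-theoretic argument of Tate type then
    makes that intersection trivial ([Tate_presidual]), so X is a normal
    complement ([normalizer_complement]).  Its inverse image lies in L, where
    theta extends.

    From a complement to an invariant extension.  Let K / N be a normal
    complement.  It is a p'-group, so the number of extensions of theta to K,
    which is the number of linear characters of K / N, is prime to p, and P
    fixes one of them.  Two P-invariant extensions differ by a P-invariant
    linear character of K / N, which is trivial because N_K(P) <= N
    ([invariant_lin_char_trivial]).  By uniqueness that extension is
    invariant under N_G(P), hence under G = K N_G(P)
    ([complement_invariant_extension]).

    From an invariant extension to all extensions.  If theta has a G-invariant
    extension k to K, then the induced character k^G restricts to theta^H.  So
    for psi over theta the multiplicity of theta in psi equals the inner
    product of psi^G and k^G, and comparing degrees shows that any common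
    constituent of these two characters extends psi
    ([extension_from_complement]). *)

Set Implicit Arguments.
Unset Strict Implicit.
Unset Printing Implicit Defensive.

Import Order.TTheory GroupScope GRing.Theory Num.Theory.
Local Open Scope ring_scope.

(** * p-residuals, transfer and Frattini quotients *)

Section GroupTheory.

Import FiniteModule.
Local Open Scope group_scope.

Variables (gT : finGroupType) (p : nat).
Implicit Types G L M P : {group gT}.

(** The p-residual of G, that is, its smallest normal subgroup of p-power index.
    Generating it by p'-elements makes containments easy to test. *)
Definition presidual G := <<[set x in G | p^'.-elt x]>>.

Canonical presidual_group G := Eval hnf in [group of presidual G].

Lemma mem_presidual G x : x \in G -> p^'.-elt x -> x \in presidual G.
Proof. by move=> Gx p'x; rewrite mem_gen // inE Gx. Qed.

Lemma presidual_subP G (A : {group gT}) :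
  reflect {in G, forall x, p^'.-elt x -> x \in A} (presidual G \subset A).
Proof.
rewrite gen_subG; apply: (iffP subsetP) => sGA x.
  by move=> Gx p'x; apply: sGA; rewrite inE Gx.
by rewrite inE => /andP[/sGA]; apply.
Qed.

Lemma presidual_char G : presidual G \char G.
Proof.
apply/charP; split; first by apply/presidual_subP.
move=> f injf defG; apply/eqP; rewrite eqEcard card_injm ?leqnn //; last first.
  by apply/presidual_subP.
rewrite andbT sub_morphim_pre; last by apply/presidual_subP.
apply/presidual_subP=> x Gx p'x; have := mem_morphim f Gx Gx; rewrite defG => Gfx.
by rewrite inE Gx inE mem_presidual ?morph_p_elt.
Qed.

Lemma presidual_normal G : presidual G <| G.
Proof. exact: char_normal (presidual_char G). Qed.

Lemma pgroup_quotient_presidual G : p.-group (G / presidual G).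
Proof.
apply/pgroupP=> q q_pr /Cauchy[] // _ /morphimP[x nXx Gx ->] oq.
apply: contraTeq (prime_gt1 q_pr) => neq_qp.
have Xx': x.`_p^' \in presidual G by rewrite mem_presidual ?groupX ?p_elt_constt.
have : p.-elt (coset (presidual G) x).
  rewrite -[x](consttC p) morphM ?groupX //= (coset_id Xx') mulg1.
  by rewrite morph_p_elt ?groupX ?p_elt_constt.
by rewrite /p_elt oq pnatE // => /eqP eq_qp; rewrite eq_qp !inE eqxx in neq_qp.
Qed.

Lemma presidual_mul_Sylow G P : p.-Sylow(G) P -> presidual G * P = G.
Proof.
move=> sylP; have nsXG := presidual_normal G; have nXG := normal_norm nsXG.
have nXP := subset_trans (pHall_sub sylP) nXG.
apply/eqP; rewrite eqEsubset mul_subG ?(normal_sub nsXG) ?(pHall_sub sylP) //=.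
rewrite -quotientSK // -(pHall_id (quotient_pHall nXP sylP)) //.
exact: pgroup_quotient_presidual.
Qed.

(** Two elements of the abelian group P that are conjugate in G are conjugate in
    N_G(P) = P, hence equal.  So the transfer from G to P raises x in P to the
    power |G : P|, which is prime to p; and it kills the p'-elements. *)
Lemma Burnside_presidual G P :
  p.-Sylow(G) P -> abelian P -> 'N_G(P) \subset P -> presidual G :&: P = 1.
Proof.
move=> sylP abP nPP; have sPG := pHall_sub sylP.
(* fusion in P: P and P^y are Sylow subgroups of the centralizer of a^y *)
have fusion a y : y \in G -> a \in P -> a ^ y \in P -> a ^ y = a.
  move=> Gy Pa Pay; have Ga := subsetP sPG a Pa.
  have sylC (Q : {group gT}) b : p.-Sylow(G) Q -> abelian Q -> b \in Q ->
      p.-Sylow('C_G[b]) Q.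
    move=> sylQ abQ Qb; apply: pHall_subl (sylQ); rewrite ?subsetIl //.
    by rewrite subsetI (pHall_sub sylQ) sub_cent1 (subsetP abQ).
  have sylPy : p.-Sylow(G) (P :^ y) by rewrite pHallJ.
  have abPy : abelian (P :^ y) by rewrite abelianJ.
  have Pyay : a ^ y \in P :^ y by rewrite memJ_conjg.
  have [c] := Sylow_trans (sylC _ _ sylPy abPy Pyay) (sylC _ _ sylP abP Pay).
  rewrite /= => /setIP[Gc Cc] defP.
  have Pyc: y * c \in P.
    by rewrite (subsetP nPP) // inE groupM // inE conjsgM -defP /=.
  have <-: (a ^ y) ^ c = a ^ y by apply/conjg_fixP/commgP/commute_sym/cent1P.
  rewrite -conjgM.
  apply/conjg_fixP/commgP; exact: (centsP abP).
have [sAP sPA] : idm P @* P \subset P /\ P \subset idm P @* P.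
  by rewrite morphim_idm.
have abA : abelian (idm P @* P) by rewrite morphim_idm.
pose V := @transfer _ _ G P (idm_morphism P) abA.
pose f x := fmval (V x).
have fM : {in G &, {morph f : x y / x * y}}.
  by move=> x y Gx Gy; rewrite /f /V transferM //= fmvalA.
have f_P x : f x \in P by apply: (subsetP sAP _ (fmodP (V x))).
have f_residual x : x \in presidual G -> f x = 1.
  suffices /subsetP sXk : presidual G \subset 'ker (Morphism fM).
    by move/sXk/mker.
  apply/presidual_subP=> y Gy p'y; rewrite inE Gy !inE /=.
  have p'fy : p^'.-elt (f y) by apply: (morph_p_elt (Morphism fM)).
  have pfy : p.-elt (f y) by apply: mem_p_elt (pHall_pgroup sylP) (f_P y).
  by rewrite -order_eq1 (pnat_1 pfy p'fy).
apply/trivgP/subsetP=> x /setIP[Xx Px]; rewrite inE.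
have Gx := subsetP sPG x Px.
have := f_residual x Xx; rewrite /f /V.
have trX := transversalP (rcosets_cycle_partition sPG Gx).
rewrite (transfer_cycle_expansion sPG abA Gx trX) /=.
set X := transversal _ _.
rewrite (eq_bigr (fun y => fmod abA x *+ #|<[x]> : P :* y|)) => [|y Xy]; last first.
  have Gy := subsetP (transversal_sub trX) y Xy.
  have Py : (x ^+ #|<[x]> : P :* y|) ^ y^-1 \in P.
    by rewrite conjgE invgK mulgA -mem_rcoset mulg_exp_card_rcosets.
  rewrite /restrm /= fusion ?groupV ?groupX //.
  by rewrite fmodX // (subsetP sPA).
rewrite sumrMnr (sum_index_rcosets_cycle sPG Gx trX) fmvalZ fmodK ?(subsetP sPA) // => xm1.
have: p.-elt x := mem_p_elt (pHall_pgroup sylP) Px.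
have: p^'.-elt x.
  by case/and3P: sylP => _ _; apply: pnat_dvd; rewrite order_dvdn xm1.
by move=> p'x px; rewrite -order_eq1 (pnat_1 px p'x).
Qed.

(** P is a Sylow subgroup of MP, which is normal in N_G(MP), so the Frattini
    argument gives N_G(MP) = M N_G(P). *)
Lemma quotient_norm_Sylow G M P :
  M <| G -> p.-Sylow(G) P -> 'N_(G / M)(P / M) = 'N_G(P) / M.
Proof.
move=> nsMG sylP; have [sMG nMG] := andP nsMG.
have sPG := pHall_sub sylP; have nMP := subset_trans sPG nMG.
have sMQ : M \subset M <*> P := joing_subl M P.
have sQG : M <*> P \subset G by rewrite join_subG sMG.
have nsMQ : M <| M <*> P by rewrite /normal sMQ (subset_trans sQG).
have sylPQ : p.-Sylow(M <*> P) P by apply: pHall_subl (sylP); rewrite ?joing_subr.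
have nsQN : M <*> P <| 'N_G(M <*> P) by rewrite normal_subnorm.
rewrite -(quotientYidl nMP) -quotient_subnormG //; apply/eqP.
rewrite eqEsubset andbC quotientS /=; last first.
  rewrite subsetI subsetIl /= normsY //; last exact: subsetIr.
  by rewrite subIset ?nMG.
rewrite quotientSK; last by rewrite subIset ?nMG.
have /= <- := Frattini_arg nsQN sylPQ.
rewrite [in X in X \subset _]norm_joinEr // -mulgA mulgS //.
rewrite mul_subG //; first by rewrite subsetI sPG normG.
by rewrite setSI // subsetIl.
Qed.

End GroupTheory.

(** * Invariant characters under p-groups, and a theorem of Tate type *)

Section TateArgument.

Variables (gT : finGroupType) (p : nat).
Implicit Types A G H K L M N P Q X : {group gT}.

Lemma conjg_Iirr_is_action G N :
  N <| G -> is_action G (fun (i : Iirr N) y => conjg_Iirr i y).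
Proof.
move=> nsNG; split=> [y i j /conjg_Iirr_inj // | i x y Gx Gy].
by apply: irr_inj; rewrite -[LHS]/('chi__) -[RHS]/('chi__) !conjg_IirrE (cfConjgM _ nsNG).
Qed.

(** An orbit of A that is not a fixed point has length divisible by p and f is
    constant on it, so only the fixed points contribute to the sum modulo p.
    This is how invariant characters are produced below. *)
Lemma pgroup_invariant_irr N A (f : Iirr N -> nat) :
    p.-group A -> A \subset 'N(N) ->
    (forall i y, y \in A -> f (conjg_Iirr i y) = f i) ->
    ~~ (p %| \sum_i f i)%N ->
  exists2 i, A \subset 'I['chi_i] & ~~ (p %| f i)%N.
Proof.
move=> pA nNA fA.
have nsNG : N <| N <*> A by rewrite normalYl.
have actN := conjg_Iirr_is_action nsNG.
pose to := Action actN.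
case: (pickP [pred i | (A \subset 'I['chi_i]) && ~~ (p %| f i)%N]) => [i /andP[] | no_i].
  by exists i.
case/negP; pose m := \max_i f i.
rewrite (partition_big (fun i => inord (f i) : 'I_m.+1) predT) //=.
apply: dvdn_sum => v _.
have fE i : (inord (f i) == v) = (f i == v).
  by rewrite -val_eqE /= inordK // ltnS leq_bigmax.
rewrite (eq_bigl _ _ fE) (eq_bigr (fun=> v : nat)) => [|i /eqP //].
rewrite sum_nat_const; case: (boolP (p %| v)%N) => [|p'v]; first exact: dvdn_mull.
(* the level set of f at v is A-stable without fixed points, so p divides its size *)
apply: dvdn_mulr; pose S := [set i | f i == v].
have actS : [acts A, on S | to].
  apply/subsetP=> y Ay; rewrite !inE mem_gen ?inE ?Ay ?orbT //=.
  by apply/subsetP=> i; rewrite !inE /= fA.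
rewrite -[#|_|](cardsE (fun i => f i == v)) -/S /dvdn.
rewrite (pgroup_fix_mod pA actS).
rewrite (_ : 'Fix_(S | to)(A) = set0) ?cards0 ?mod0n //.
apply/setP=> i; rewrite in_set0; apply/negP=> /setIP[]; rewrite inE => /eqP fi /afixP fixi.
have /= := no_i i; rewrite fi p'v andbT => /negP[]; apply/subsetP=> y Ay.
by rewrite inE (subsetP nNA) //= -conjg_IirrE; apply/eqP; congr 'chi__; apply: fixi.
Qed.


Lemma lin_irrE G (i : Iirr G) : ('chi_i \is a linear_char) = ('chi_i 1%g == 1).
Proof. by rewrite qualifE /= irr_char. Qed.

(** There are |Q : Q'| linear characters, a multiple of p, so the number of
    nontrivial ones is prime to p. *)
Lemma pgroup_nontrivial_invariant_lin P Q :
    p.-group P -> prime p -> Q <| P -> Q :!=: 1%g ->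
  exists i : Iirr Q, [/\ 'chi_i \is a linear_char, i != 0 & P \subset 'I['chi_i]].
Proof.
move=> pP p_pr nsQP ntQ; have pQ := pgroupS (normal_sub nsQP) pP.
pose f (i : Iirr Q) := nat_of_bool (('chi_i \is a linear_char) && (i != 0)).
have fP i y : y \in P -> f (conjg_Iirr i y) = f i.
  by move=> _; rewrite /f conjg_Iirr_eq0 !lin_irrE conjg_IirrE cfConjg1.
have [|i Ii] := pgroup_invariant_irr pP (normal_norm nsQP) fP.
  suffices: (p %| (\sum_i f i).+1)%N -> ~~ (p %| \sum_i f i)%N.
    apply; have -> : ((\sum_i f i).+1 = #|Q : Q^`(1)%g|)%N.
      rewrite -card_lin_irr (cardD1 0) inE /= irr0 cfun1_lin_char add1n.
      rewrite /f -sum1_card [in RHS]big_mkcond /=; congr _.+1.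
      by apply: eq_bigr => j _; rewrite !inE andbC; case: ifP.
    have ltQ'Q : Q^`(1)%g \proper Q.
      exact: sol_der1_proper (pgroup_sol pQ) (subxx Q) ntQ.
    have [|_ pdvd _] := pgroup_pdiv (quotient_pgroup Q^`(1) pQ).
      by rewrite -subG1 quotient_sub1 ?gFnorm // proper_subn.
    by rewrite -card_quotient ?gFnorm.
  by move=> pS; apply: contraL pS => pS; rewrite -addn1 dvdn_addr // Euclid_dvd1.
rewrite /f; case: andP => [[lin_i nz_i] _|]; last by rewrite dvdn0.
by exists i.
Qed.

Lemma dvdC_natr (m n : nat) : (m%:R %| n%:R)%C = (m %| n)%N.
Proof. exact: dvdC_nat. Qed.

Lemma exists_ndvdC (I : finType) (F : I -> algC) :
  ~~ (p%:R %| \sum_i F i)%C -> exists i, ~~ (p%:R %| F i)%C.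
Proof.
move=> ndvd; apply/existsP; apply: contraR ndvd => /existsPn dvdF.
by apply: rpred_sum => i _; have := dvdF i; rewrite negbK.
Qed.

(** Let X be the residual and Q its Sylow subgroup X n P.  If Q is nontrivial it
    has a nontrivial P-invariant linear character l.  As l^X has degree prime to
    p, some P-invariant constituent t of it has degree and multiplicity prime to
    p.  The determinant of t has p'-order since X is generated by p'-elements,
    so t extends to G; restricting that extension to P yields an extension of l
    to a linear character of P, which is trivial on Q since Q <= P'. *)
Theorem Tate_presidual G P :
    prime p -> p.-Sylow(G) P -> presidual p G :&: P \subset P^`(1)%g ->
  presidual p G :&: P = 1%g.
Proof.
move=> p_pr sylP sQP'; set X := presidual_group p G.
have nsXG : X <| G := presidual_normal p G; have [sXG nXG] := andP nsXG.
have [sPG pP _] := and3P sylP; have nXP := subset_trans sPG nXG.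
have GE : (X * P)%g = G := presidual_mul_Sylow sylP.
apply/eqP; apply: contraT => ntQ; pose Q := (X :&: P)%G.
have sQX : Q \subset X by apply: subsetIl.
have sQP : Q \subset P by apply: subsetIr.
have nsQP : Q <| P by rewrite /normal sQP normsI ?normG.
have [l [lin_l nz_l Il]] := pgroup_nontrivial_invariant_lin pP p_pr nsQP ntQ.
have IndI y : y \in P -> ('Ind[X] 'chi_l ^ y)%CF = 'Ind[X] 'chi_l.
  move=> Py; rewrite cfConjgInd_norm ?(subsetP nXP) ?(subsetP (normal_norm nsQP)) //.
  by rewrite (inertiaJ (subsetP Il y Py)).
pose f (i : Iirr X) := Num.truncn ('['Ind[X] 'chi_l, 'chi_i] * 'chi_i 1%g).
have natf i : (f i)%:R = '['Ind[X] 'chi_l, 'chi_i] * 'chi_i 1%g.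
  by rewrite truncnK // rpredM ?Cnat_irr1 // Cnat_cfdot_char_irr // cfInd_char ?irr_char.
have fP i y : y \in P -> f (conjg_Iirr i y) = f i.
  move=> Py; congr Num.truncn; rewrite conjg_IirrE cfConjg1; congr (_ * _).
  by rewrite -{1}(IndI y Py) cfConjg_iso.
have sylQ : p.-Sylow(X) Q by apply: Sylow_setI_normal sylP.
have [|t IPt] := pgroup_invariant_irr pP nXP fP.
  have -> : (\sum_i f i)%N = #|X : Q|.
    apply/eqP; rewrite -(eqr_nat algC) natr_sum (eq_bigr _ (fun i _ => natf i)).
    have -> : #|X : Q|%g%:R = 'Ind[X] 'chi_l 1%g.
      by rewrite cfInd1 // (lin_char1 lin_l) mulr1.
    apply/eqP; rewrite [in RHS](cfun_sum_cfdot ('Ind _)).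
    by rewrite sum_cfunE; apply: eq_bigr => i _; rewrite cfunE.
  by case/and3P: sylQ => _ _; rewrite p'natE.
rewrite -dvdC_natr natf => ndvd_t.
have IGt : G \subset 'I['chi_t] by rewrite -GE mul_subG ?sub_inertia.
have pGX : p.-group (G / X)%g := pgroup_quotient_presidual p G.
(* the degree and the determinantal order of t are both prime to p *)
have co_t : coprime #|G : X|%g ('o('chi_t)%CF * Num.truncn ('chi_t 1%g)).
  have pGXi : p.-nat #|G : X|%g by rewrite -card_quotient.
  rewrite (pnat_coprime pGXi) // pnatM; apply/andP; split; last first.
    rewrite p'natE //; apply: contra ndvd_t.
    rewrite -dvdC_natr truncnK ?Cnat_irr1 //.
    by apply: dvdC_mull; rewrite intr_nat ?Cnat_cfdot_char_irr // cfInd_char ?irr_char.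
  pose k := (#|G|`_p^')%N.
  apply: (@pnat_dvd _ k); last exact: part_pnat.
  rewrite dvdn_cforder.
  have: X \subset cfker (cfDet 'chi_t ^+ k).
    have lin_k : cfDet 'chi_t ^+ k \is a linear_char by rewrite rpredX ?cfDet_lin_char.
    apply/presidual_subP=> x Gx p'x; have Xx := mem_presidual Gx p'x.
    rewrite /= cfkerEchar ?lin_charW // inE Xx (lin_char1 lin_k) exp_cfunE //.
    rewrite -lin_charX ?cfDet_lin_char //.
    suffices /eqP-> : (x ^+ k == 1)%g by rewrite lin_char1 ?cfDet_lin_char /=.
    by rewrite -order_dvdn -(part_pnat_id p'x) partn_dvd ?cardG_gt0 ?order_dvdG.
  move/cfRes_sub_ker; rewrite cfRes_id => ->.
  by rewrite exp_cfunE // lin_char1 ?cfDet_lin_char // expr1n scale1r.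
have [c [Rc _ _]] := extend_solvable_coprime_irr nsXG (pgroup_sol pGX) IGt co_t.
(* the multiplicity of l in t is prime to p, so so is its multiplicity in
   some constituent of the restriction to P *)
have [m ndvd_m] : exists m : Iirr P, ~~ (p%:R %| '['Res[Q] 'chi_m, 'chi_l])%C.
  have [|m nd] := exists_ndvdC (F := fun m : Iirr P =>
      '['Res[P] 'chi_c, 'chi_m] * '['Res[Q] 'chi_m, 'chi_l]).
    apply: contra ndvd_t => dvd_s; rewrite dvdC_mulr ?intr_nat ?Cnat_irr1 //.
    rewrite -cfdot_Res_r -Rc cfResRes // -(cfResRes _ sQP sPG) cfdotC.
    rewrite (cfun_sum_cfdot ('Res[P] _)) linear_sum cfdot_suml.
    rewrite (eq_bigr (fun m => '['Res[P] 'chi_c, 'chi_m] * '['Res[Q] 'chi_m, 'chi_l])).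
      rewrite conj_natr // rpred_sum // => m _.
      by rewrite rpredM ?Cnat_cfdot_char ?cfRes_char ?irr_char.
    by move=> m _; rewrite linearZ cfdotZl.
  exists m; apply: contra nd; apply: dvdC_mull.
  by rewrite intr_nat // Cnat_cfdot_char ?cfRes_char ?irr_char.
have lm : l \in irr_constt ('Res[Q] 'chi_m).
  by rewrite irr_consttE; apply: contraNneq ndvd_m => ->; rewrite dvdC0.
have Rm : 'Res[Q] 'chi_m = '['Res[Q] 'chi_m, 'chi_l] *: 'chi_l.
  by rewrite {1}(Clifford_Res_sum_cfclass nsQP lm) cfclass_invariant // big_seq1.
(* by invariance of l, the degree of m is that multiplicity; being prime to p
   and a power of p, it is 1 *)
have lin_m : 'chi_m \is a linear_char.
  have m1 : 'chi_m 1%g = '['Res[Q] 'chi_m, 'chi_l].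
    by rewrite -(cfRes1 Q) Rm cfunE (lin_char1 lin_l) mulr1 -Rm.
  rewrite lin_irrE; have /natrP[n Dn] := Cnat_irr1 m; rewrite Dn.
  rewrite pnatr_eq1 (@pnat_1 p n) //.
    have := dvd_irr1_cardG m; rewrite Dn dvdC_natr => nP; exact: pnat_dvd nP pP.
  by rewrite p'natE // -dvdC_natr -Dn m1.
case/eqP: nz_l; apply: irr_inj; rewrite -[LHS]/('chi_l) -[RHS]/('chi_0) irr0.
have := Rm; rewrite cfRes_sub_ker ?(subset_trans sQP') -?lin_irr_der1 //.
rewrite (lin_char1 lin_m) scale1r => E1.
move: (congr1 (fun phi : 'CF(Q) => phi 1%g) E1).
by rewrite cfunE (lin_char1 lin_l) mulr1 cfun11 => d1; rewrite E1 -d1 scale1r.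
Qed.

End TateArgument.

(** * Normal complements to a Sylow normalizer *)

Section NormalizerComplement.

Local Open Scope group_scope.

Variables (gT : finGroupType) (p : nat).
Implicit Types G H K L M N P Q X : {group gT}.

(** Modulo M the Sylow subgroup P of L is abelian and its own normalizer, so the
    p-residual X of L meets P inside M, hence inside P'; then X n P = 1 and X is
    a p'-group.  Frattini's G = L N_G(P) = X P N_G(P) concludes. *)
Lemma normalizer_complement G L M P :
    prime p -> p.-Sylow(G) P -> L <| G -> M <| G -> M \subset L -> P \subset L ->
    'N_L(P) \subset P -> P^`(1) \subset M -> M :&: P \subset P^`(1) ->
  exists X : {group gT},
    [/\ X <| G, X \subset L, X * 'N_G(P) = G & X :&: 'N_G(P) = 1].
Proof.
move=> p_pr sylP nsLG nsMG sML sPL nLP sP'M sMP'; have [sLG nLG] := andP nsLG.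
have nsML : M <| L := normalS sML sLG nsMG; have nML := normal_norm nsML.
have sylPL : p.-Sylow(L) P by apply: pHall_subl (sylP).
pose X := presidual_group p L.
have XP1 : X :&: P = 1.
  apply: Tate_presidual => //; apply: subset_trans sMP'.
  rewrite subsetI subsetIr andbT.
  have nMX : X \subset 'N(M) by apply: subset_trans nML; apply/presidual_subP.
  rewrite -quotient_sub1 ?subIset ?nMX //.
  apply: (subset_trans (quotientI _ _ _)).
  have <- : presidual p (L / M) :&: (P / M) = 1.
    apply: Burnside_presidual (quotient_pHall (subset_trans sPL nML) sylPL) _ _.
      by rewrite sub_der1_abelian.
    by rewrite (quotient_norm_Sylow nsML sylPL) quotientS.
  apply: setSI; rewrite sub_quotient_pre //; apply/presidual_subP=> x Lx p'x.
  by rewrite inE (subsetP nML) // inE mem_presidual ?mem_quotient ?morph_p_elt ?(subsetP nML).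
have nsXG : X <| G := char_normal_trans (presidual_char p L) nsLG.
have sXL : X \subset L by apply/presidual_subP.
have LE : X * P = L := presidual_mul_Sylow sylPL.
exists X; split=> //; last first.
  apply/trivgP; rewrite -XP1 subsetI subsetIl /=.
  by apply: subset_trans nLP; rewrite setISS ?subsetIr.
have sPN : P \subset 'N_G(P) by rewrite subsetI (pHall_sub sylP) normG.
by rewrite -(mulSGid sPN) mulgA LE; apply: Frattini_arg sylPL.
Qed.

End NormalizerComplement.

(** * Relative kernels *)

Lemma scale_nat_char (gT : finGroupType) (G : {group gT}) a (chi : 'CF(G)) :
  a \in Num.nat -> chi \is a character -> a *: chi \is a character.
Proof. by case/natrP=> n -> Nchi; rewrite scaler_nat rpredMn. Qed.

Lemma cfdot_cfun1_eq_cfker (gT : finGroupType) (G : {group gT}) (chi : 'CF(G)) :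
  chi \is a character -> ('[chi, 1] == chi 1%g) = (G \subset cfker chi).
Proof.
move=> Nchi; apply/eqP/idP=> [d1 | sGk]; last first.
  rewrite -{1}[chi](cfRes_id chi) cfRes_sub_ker //.
  by rewrite cfdotZl cfnorm1 mulr1.
suffices -> : chi = chi 1%g *: 1.
  by apply: subset_trans (cfker_scale _ _); rewrite cfker_cfun1.
have [psi Npsi Dchi] : exists2 psi, psi \is a character & chi = chi 1%g *: 1 + psi.
  exists (\sum_(i | i != 0) '[chi, 'chi_i] *: 'chi_i).
    apply: rpred_sum => i _.
    by rewrite scale_nat_char ?irr_char ?Cnat_cfdot_char_irr.
  by rewrite {1}(cfun_sum_cfdot chi) (bigD1 0) //= irr0 d1.
suffices /eqP psi0 : psi == 0 by rewrite {1}Dchi psi0 addr0.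
rewrite -char1_eq0 // -(inj_eq (addrI (chi 1%g))) addr0.
have: (chi 1%g *: 1 + psi) 1%g = chi 1%g by rewrite -Dchi.
by rewrite 2!cfunE cfun11 mulr1 => ->.
Qed.

Section RelativeKernel.

Variable gT : finGroupType.
Implicit Types C G H K L M N P Q R T : {group gT}.

(** Here beta is the character of G / N on the N-fixed points of a module affording
    phi.  It is built from its inner products, those of phi with inflated
    characters; applied to permutation characters they give the formula. *)
Lemma quotient_fixed_part G N (phi : 'CF(G)) :
    N <| G -> phi \is a character ->
  exists2 beta : 'CF(G / N), beta \is a character
    & forall T, N \subset T -> T \subset G ->
        '['Res[T] phi, 1] = '['Res[T / N] beta, 1].
Proof.
move=> nsNG Nphi; have [sNG nNG] := andP nsNG.
pose beta : 'CF(G / N) := \sum_i '[phi, 'chi_i %% N]%CF *: 'chi_i.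
have betaE (gam : 'CF(G / N)) : '[beta, gam] = '[phi, gam %% N]%CF.
  rewrite [in RHS](cfun_sum_cfdot gam) linear_sum cfdot_sumr /beta cfdot_suml.
  by apply: eq_bigr => i _; rewrite linearZ cfdotZl cfdotZr mulrC -cfdotC.
exists beta => [|T sNT sTG].
  apply: rpred_sum => i _; apply: scale_nat_char (irr_char i).
  by rewrite Cnat_cfdot_char // cfMod_char ?irr_char.
rewrite !cfdot_Res_l betaE; congr '[_, _].
have <- : 'Ind[G, T] (1 %% N)%CF = ('Ind[G / N] (1 : 'CF(T / N)) %% N)%CF.
  by apply: cfIndMorph; rewrite ?ker_coset.
by rewrite cfMod_cfun1.
Qed.

End RelativeKernel.

Section CharacterTools.

Variable gT : finGroupType.
Implicit Types C G H K L M N P Q R T : {group gT}.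

(** The norm of S on T is the multiplicity of the principal character of T in
    S S^*, which only sees the N-fixed part beta of S S^*.  On N it is the degree
    of beta, and equality on T says that T / N acts trivially: L / N = ker beta. *)
Theorem relative_kernel G N (S : 'CF(G)) :
    N <| G -> S \is a character ->
  exists2 L : {group gT}, N \subset L /\ L <| G
    & forall T, N \subset T -> T \subset G ->
        (T \subset L) = ('['Res[T] S] == '['Res[N] S]).
Proof.
move=> nsNG NS; have [sNG nNG] := andP nsNG.
have [|beta Nbeta betaE] := quotient_fixed_part (phi := S * S^*%CF) nsNG.
  by rewrite rpredM ?cfConjC_char.
have normE T : N \subset T -> T \subset G -> '['Res[T] S] = '['Res[T / N] beta, 1].
  move=> sNT sTG; rewrite -betaE // rmorphM /= -cfAutRes.
  rewrite !cfdotE; congr (_ * _); apply: eq_bigr => x Tx.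
  by rewrite !cfunE cfun1E Tx rmorph1 mulr1.
have normN : '['Res[N] S] = beta 1%g.
  rewrite normE // trivg_quotient -(cfRes1 1%G) cfdotE cards1 invr1 mul1r.
  by rewrite big_set1 cfun11 rmorph1 mulr1.
exists (coset N @*^-1 (cfker beta))%G => [|T sNT sTG].
  split; first by rewrite sub_cosetpre.
  rewrite /= -[X in _ <| X](quotientGK nsNG) cosetpre_normal.
  exact: cfker_normal.
have nNT := subset_trans sTG nNG.
rewrite -sub_quotient_pre // normE // normN -(cfRes1 (T / N)%G).
rewrite cfdot_cfun1_eq_cfker ?cfRes_char //.
by rewrite cfker_Res ?quotientS // subsetI subxx.
Qed.

Lemma constt_homogeneous T N (t : Iirr N) (S : 'CF(T)) e i :
    S \is a character -> 'Res[N] S = e *: 'chi_t -> i \in irr_constt S ->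
  'Res[N] 'chi_i = '['Res[N] 'chi_i, 'chi_t] *: 'chi_t.
Proof.
move=> NS RS Si; rewrite {1}(cfun_sum_cfdot ('Res _)) (bigD1 t) //=.
rewrite big1 ?addr0 // => j ne_jt; suffices -> : '['Res[N] 'chi_i, 'chi_j] = 0.
  by rewrite scale0r.
apply: contraNeq ne_jt; rewrite -irr_consttE => /(constt_Res_trans NS Si).
rewrite RS irr_consttE cfdotZl cfdot_irr mulf_eq0 negb_or => /andP[_].
by rewrite pnatr_eq0 eqb0 negbK eq_sym.
Qed.

Lemma norm_extension T N (t : Iirr N) (S : 'CF(T)) e x :
  'Res[N] 'chi[T]_x = 'chi_t -> S = e *: 'chi_x -> N \subset T ->
  '[S] = '['Res[N] S].
Proof. by move=> Rx -> _; rewrite linearZ /= Rx !cfnormZ !cfnorm_irr. Qed.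

(** Let a_i be the multiplicities in S and f_i the multiplicity of t in chi_i.
    Then e = sum a_i f_i, and f_i >= 1 for each constituent, while the norm
    condition reads e^2 = sum a_i^2.  The terms a_i (e f_i - a_i) are therefore
    nonnegative with sum zero, which leaves a single constituent, with f_i = 1
    and multiplicity e. *)
Lemma extension_of_norm T N (t : Iirr N) (S : 'CF(T)) e :
    S \is a character -> S != 0 -> 'Res[N] S = e *: 'chi_t ->
    '[S] = '['Res[N] S] ->
  exists2 x : Iirr T, 'Res[N] 'chi_x = 'chi_t & S = e *: 'chi_x.
Proof.
move=> NS nzS RS normS.
pose a i := '[S, 'chi_i]; pose f (i : Iirr T) := '['Res[N] 'chi_i, 'chi_t].
have Na i : a i \in Num.nat by apply: Cnat_cfdot_char_irr.
have Nf i : f i \in Num.nat by rewrite Cnat_cfdot_char_irr ?cfRes_char ?irr_char.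
have De : e = \sum_i a i * f i.
  transitivity '['Res[N] S, 'chi_t]; first by rewrite RS cfdotZl cfnorm_irr mulr1.
  rewrite {1}(cfun_sum_cfdot S) linear_sum cfdot_suml.
  by apply: eq_bigr => i _; rewrite linearZ cfdotZl.
have Ne : e \in Num.nat by rewrite De rpred_sum // => i _; rewrite rpredM.
have ge0 x : x \in Num.nat -> 0 <= x :> algC by apply: natr_ge0.
have af_le_e i : a i * f i <= e.
  rewrite De (bigD1 i) //= lerDl sumr_ge0 // => j _.
  by rewrite ge0 // rpredM.
have f_ge1 i : a i != 0 -> 1 <= f i.
  rewrite -irr_consttE => Si; have /natrP[n Dn] := Nf i; rewrite Dn ler1n lt0n.
  rewrite -(eqr_nat algC) -Dn; apply: contraNneq (Res_irr_neq0 N i) => f0.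
  by rewrite (constt_homogeneous NS RS Si) -/(f i) f0 scale0r.
have a_le i : a i <= e * f i.
  have [-> | nz_a] := eqVneq (a i) 0; first by rewrite mulr_ge0 ?ge0.
  apply: (@le_trans _ _ (a i * f i)); first by rewrite ler_peMr ?ge0 ?f_ge1.
  apply: (@le_trans _ _ e) => //; by rewrite ler_peMr ?ge0 ?f_ge1.
have nz_e : e != 0.
  apply: contraNneq nzS => e0; rewrite -(cfRes_eq0 N) // RS e0 scale0r eqxx //.
have [x Sx] := neq0_has_constt nzS.
have nz_ax : a x != 0 by rewrite -irr_consttE.
have eq_a : a x = e * f x.
  have : \sum_i (a i * (e * f i - a i)) = 0.
    rewrite (eq_bigr (fun i => e * (a i * f i) - a i * a i)) => [|i _].
      rewrite sumrB -mulr_sumr -De; apply/eqP; rewrite subr_eq0; apply/eqP.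
      have := normS; rewrite RS cfnormZ cfnorm_irr mulr1 => normSe.
      rewrite -expr2 -[e in LHS]ger0_norm ?ge0 // -normSe cfdot_sum_irr.
      by apply: eq_bigr => i _; rewrite [X in _ * X = _]conj_natr ?Na.
    by rewrite mulrBr mulrCA.
  have a_ge0 i : true -> 0 <= a i * (e * f i - a i).
    by move=> _; rewrite mulr_ge0 ?subr_ge0 ?ge0.
  move/(psumr_eq0P a_ge0)/(_ x isT)/eqP.
  by rewrite mulf_eq0 subr_eq0 (negPf nz_ax) eq_sym => /eqP.
have fx1 : f x = 1.
  apply/le_anti; rewrite f_ge1 // andbT.
  have := af_le_e x; rewrite eq_a -mulrA ger_pMr; last by rewrite lt0r nz_e ge0.
  apply: le_trans; rewrite ler_peMr ?ge0 ?f_ge1 //.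
have Rx : 'Res[N] 'chi_x = 'chi_t.
  by rewrite (constt_homogeneous NS RS Sx) -/(f x) fx1 scale1r.
exists x => //; have [S' NS' DS] : exists2 S', S' \is a character & S = a x *: 'chi_x + S'.
  exists (\sum_(i | i != x) a i *: 'chi_i); last by rewrite {1}(cfun_sum_cfdot S) (bigD1 x).
  by apply: rpred_sum => i _; apply: scale_nat_char (irr_char i).
rewrite {1}DS eq_a fx1 mulr1; suffices /eqP-> : S' == 0 by rewrite addr0.
rewrite -(cfRes_eq0 N) //; apply/eqP/(addrI ('Res[N] (a x *: 'chi_x))).
by rewrite -linearD /= -DS addr0 RS linearZ /= Rx eq_a fx1 mulr1.
Qed.

End CharacterTools.

(** * Gallagher products and relative p'-degree *)

Section Gallagher.

Variable gT : finGroupType.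
Implicit Types C G H K L M N P Q R T : {group gT}.

Variables (G N : {group gT}) (t : Iirr N) (c : Iirr G).
Hypotheses (nsNG : N <| G) (Rc : 'Res[N] 'chi_c = 'chi_t).

Lemma Gallagher_irr (b : Iirr (G / N)) : ('chi_b %% N)%CF * 'chi_c \in irr G.
Proof. by have [irrM _ _ _] := constt_Ind_ext nsNG Rc; rewrite -mod_IirrE. Qed.

Lemma Gallagher_inj (b b' : Iirr (G / N)) :
  ('chi_b %% N)%CF * 'chi_c = ('chi_b' %% N)%CF * 'chi_c -> b = b'.
Proof.
have [_ inj _ _] := constt_Ind_ext nsNG Rc; rewrite -!mod_IirrE // => eq_bb'.
by apply: inj; rewrite /mul_mod_Iirr /mul_Iirr eq_bb'.
Qed.

Lemma Gallagher_onto i : t \in irr_constt ('Res[N] 'chi[G]_i) ->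
  exists b : Iirr (G / N), 'chi_i = ('chi_b %% N)%CF * 'chi_c.
Proof.
have [irrM _ onto _] := constt_Ind_ext nsNG Rc.
rewrite -constt_Ind_Res onto => /codomP[b ->]; exists b.
by rewrite /mul_mod_Iirr /mul_Iirr cfIirrE ?mod_IirrE // -mod_IirrE.
Qed.

Lemma cfRes_mulMod (b : Iirr (G / N)) T : N \subset T -> T \subset G ->
  'Res[T] (('chi_b %% N)%CF * 'chi_c)
    = ('Res[T / N] 'chi_b %% N)%CF * 'Res[T] 'chi_c.
Proof. by move=> sNT sTG; rewrite rmorphM /= cfResMod. Qed.

Lemma cfRes_mulMod_ker (b : Iirr (G / N)) :
  'Res[N] (('chi_b %% N)%CF * 'chi_c) = 'chi_b 1%g *: 'chi_t.
Proof.
rewrite rmorphM /= Rc cfRes_sub_ker ?cfker_mod // cfMod1.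
by rewrite -scalerAl mul1r.
Qed.

End Gallagher.

Section RelativePPrime.

Variables (gT : finGroupType) (p : nat).
Implicit Types C G H K L M N P Q R T : {group gT}.

(** The relative degree of the induced character is prime to p and is the sum,
    with multiplicities, of the relative degrees of its constituents. *)
Lemma exists_irr_rel_pprime H N C (t : Iirr N) (z : Iirr C) :
    N \subset C -> C \subset H -> t \in irr_constt ('Res[N] 'chi_z) ->
    ~~ (p%:R %| #|H : C|%g%:R * ('chi_z 1%g / 'chi_t 1%g))%C ->
  exists2 i, i \in irr_rel_pprime p H t & z \in irr_constt ('Res[C] 'chi_i).
Proof.
move=> sNC sCH tz ndvd.
have [|i nd] := @exists_ndvdC p _ (fun i : Iirr H =>
    '['Ind[H] 'chi_z, 'chi_i] * ('chi_i 1%g / 'chi_t 1%g)).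
  apply: contra ndvd; rewrite mulrA -cfInd1 //.
  rewrite [in X in _ -> X](cfun_sum_cfdot ('Ind[H] 'chi_z)) sum_cfunE mulr_suml.
  by under [in X in _ -> X]eq_bigr do rewrite cfunE -mulrA.
have iz : i \in irr_constt ('Ind[H] 'chi_z).
  by rewrite irr_consttE; apply: contraNneq nd => ->; rewrite mul0r dvdC0.
rewrite constt_Ind_Res in iz; exists i => //; rewrite 2!inE.
rewrite -(cfResRes _ sNC sCH) (constt_Res_trans _ iz tz) ?cfRes_char ?irr_char //=.
apply: contra nd; apply: dvdC_mull; rewrite intr_nat //.
by rewrite Cnat_cfdot_char_irr // cfInd_char ?irr_char.
Qed.

End RelativePPrime.

(** * Relative kernels of sums of characters of relative p'-degree *)

Section KernelLevels.

Variables (gT : finGroupType) (p : nat).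
Implicit Types C G H K L M N P Q R T : {group gT}.

Lemma Res_sum_over H N (t : Iirr N) (A : {set Iirr H}) :
    N <| H -> H \subset 'I['chi_t] -> A \subset irr_over H t ->
  exists e, 'Res[N] (\sum_(i in A) 'chi_i) = e *: 'chi_t.
Proof.
move=> nsNH It sA; exists (\sum_(i in A) '['Res[N] 'chi_i, 'chi_t]).
rewrite linear_sum scaler_suml; apply: eq_bigr => i Ai /=.
have := subsetP sA i Ai; rewrite inE => ti.
by rewrite {1}(Clifford_Res_sum_cfclass nsNH ti) cfclass_invariant // big_seq1.
Qed.

Lemma sum_irr_char H (A : {set Iirr H}) :
  \sum_(i in A) 'chi_i \is a character.
Proof. by rewrite rpred_sum // => i _; apply: irr_char. Qed.

Lemma constt_sum_irr H (A : {set Iirr H}) i :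
  i \in A -> i \in irr_constt (\sum_(i in A) 'chi_i).
Proof.
move=> Ai; apply/constt_charP; first exact: sum_irr_char.
exists (\sum_(j in A :\ i) 'chi_j); first exact: sum_irr_char.
by rewrite (big_setD1 i).
Qed.

Lemma constt_scale_irr G a (i j : Iirr G) : i \in irr_constt (a *: 'chi_j) -> i = j.
Proof.
rewrite irr_consttE cfdotZl cfdot_irr mulf_eq0 negb_or pnatr_eq0 eqb0 negbK.
by case/andP=> _ /eqP.
Qed.

Variables (H N R : {group gT}) (t : Iirr N) (y : Iirr R).
Hypotheses (p_pr : prime p) (nsNH : N <| H) (nsRH : R <| H) (sNR : N \subset R).
Hypotheses (pRN : p.-group (R / N)%g) (p'HR : ~~ (p %| #|H : R|%g)%N).
Hypotheses (It : H \subset 'I['chi_t]) (Ry : 'Res[N] 'chi_y = 'chi_t).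

Let sRH : R \subset H. Proof. exact: normal_sub. Qed.
Let sNH : N \subset H. Proof. exact: normal_sub. Qed.
Let nsNR : N <| R. Proof. exact: normalS nsNH. Qed.

Let sub_rel_over : irr_rel_pprime p H t \subset irr_over H t.
Proof. by apply/subsetP=> i; rewrite inE => /andP[]. Qed.

Let rel := irr_rel_pprime p H t.
Let rely := [set i in rel | i \in irr_over H y].

Lemma extension_rel_pprime (z : Iirr R) :
  'Res[N] 'chi_z = 'chi_t ->
  exists2 i, i \in rel & z \in irr_constt ('Res[R] 'chi_i).
Proof.
move=> Rz; apply: exists_irr_rel_pprime => //.
  by rewrite Rz constt_irr inE.
by rewrite -(cfRes1 N) Rz divff ?irr1_neq0 // mulr1 dvdC_natr.
Qed.

Lemma norm_Res_irr_over (A : {set Iirr H}) :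
    H \subset 'I['chi_y] -> A \subset irr_over H y ->
  '['Res[R] (\sum_(i in A) 'chi_i)] = '['Res[N] (\sum_(i in A) 'chi_i)].
Proof.
move=> Iy sA; have [e RS] := Res_sum_over nsRH Iy sA.
by rewrite (norm_extension Ry RS sNR) cfResRes.
Qed.

(** Suppose C > R satisfies the norm equality; then the sum is on C a multiple of
    one extension x of chi_y.  For a nonprincipal b in Irr(C / R) the Gallagher
    product b x has relative degree b(1), which divides the p'-number |C : R|;
    hence some member of the sum lies over b x, which differs from x. *)
Lemma kernel_rel_over_sub C :
    H \subset 'I['chi_y] -> R \subset C -> C \subset H ->
    '['Res[C] (\sum_(i in rely) 'chi_i)]
      = '['Res[N] (\sum_(i in rely) 'chi_i)] ->
  C \subset R.
Proof.
set S := \sum_(i in _) _; move=> Iy sRC sCH normC.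
have sNC := subset_trans sNR sRC; have nsRC : R <| C := normalS sRC sCH nsRH.
have NS : S \is a character := sum_irr_char _.
have rely_over_y : rely \subset irr_over H y.
  by apply/subsetP=> i; rewrite inE => /andP[].
have nzS : S != 0.
  have [i reli yi] := extension_rel_pprime Ry.
  have : i \in irr_constt S by apply: constt_sum_irr; rewrite inE reli inE.
  by apply: contraTneq => ->; rewrite irr_consttE cfdot0l eqxx.
have rely_rel : rely \subset rel by apply/subsetP=> i; rewrite inE => /andP[].
have [e RSN] := Res_sum_over nsNH It (subset_trans rely_rel sub_rel_over).
have [||||x Rx DS] := @extension_of_norm _ C N t ('Res[C] S) e.
- exact: cfRes_char.
- by rewrite cfRes_eq0.
- by rewrite cfResRes.
- by rewrite normC cfResRes.
have nz_e : e != 0.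
  by apply: contraNneq nzS => e0; rewrite -(cfRes_eq0 N) // RSN e0 scale0r.
have [f RSR] := Res_sum_over nsRH Iy rely_over_y.
(* x extends not only theta but also eta *)
have RxR : 'Res[R] 'chi_x = 'chi_y.
  have eRx : e *: 'Res[R] 'chi_x = f *: 'chi_y.
    by rewrite -linearZ /= -DS cfResRes.
  have fe : f = e.
    move/(congr1 'Res[N]): eRx; rewrite !linearZ /= cfResRes // Rx Ry => /eqP.
    by rewrite eq_scaled_irr => /andP[/eqP].
  by move: eRx; rewrite fe; apply: scalerI.
apply: contraT => nsCR.
have ntCR : (C / R)%g != 1%g by rewrite -subG1 quotient_sub1 ?normal_norm.
have [b nz_b] := has_nonprincipal_irr ntCR.
have /irrP[z Dz] := Gallagher_irr nsRC RxR b.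
have RzR : 'Res[R] 'chi_z = 'chi_b 1%g *: 'chi_y.
  by rewrite -Dz (cfRes_mulMod_ker nsRC RxR).
have yz : y \in irr_constt ('Res[R] 'chi_z).
  by rewrite RzR irr_consttE cfdotZl cfnorm_irr mulr1 irr1_neq0.
have tz : t \in irr_constt ('Res[N] 'chi_z).
  rewrite -(cfResRes _ sNR sRC) RzR linearZ /= Ry.
  by rewrite irr_consttE cfdotZl cfnorm_irr mulr1 irr1_neq0.
have [|i reli zi] := @exists_irr_rel_pprime _ p H N C t z sNC sCH tz.
  have z1 : 'chi_z 1%g = 'chi_b 1%g * 'chi_t 1%g.
    by rewrite -(cfRes1 R) RzR cfunE -Ry cfRes1.
  rewrite z1 mulfK ?irr1_neq0 //.
  have /natrP[d Dd] := Cnat_irr1 b; rewrite Dd -natrM dvdC_natr.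
  have := dvd_irr1_cardG b; rewrite Dd dvdC_natr card_quotient ?normal_norm // => d_dvd.
  (* b(1) divides |C : R| *)
  have dvd_HR : (#|H : C|%g * d %| #|H : R|%g)%N.
    by rewrite -(Lagrange_index sCH sRC) dvdn_mul.
  by apply: contra p'HR => /dvdn_trans->.
have rely_i : i \in rely.
  rewrite inE reli inE -(cfResRes _ sRC sCH).
  by apply: (constt_Res_trans _ zi yz); rewrite cfRes_char ?irr_char.
have : z \in irr_constt ('Res[C] S).
  exact: (constt_Res_trans NS (constt_sum_irr rely_i) zi).
rewrite DS => /constt_scale_irr zx; case/eqP: nz_b.
apply: (Gallagher_inj nsRC RxR).
by rewrite Dz zx irr0 cfMod_cfun1 mul1r.
Qed.

Lemma Res_lin_char_der1 (b : Iirr (R / N)) T :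
    T \subset R -> (T / N \subset (R / N)^`(1))%g -> 'chi_b \is a linear_char ->
  'Res[T / N] 'chi_b = 1.
Proof.
move=> sTR sTR' lin_b; rewrite cfRes_sub_ker.
  by rewrite (lin_char1 lin_b) scale1r.
by apply: subset_trans sTR' _; rewrite -lin_irr_der1.
Qed.

(** A constituent of relative degree prime to p restricts to R as a sum of
    products of chi_y with linear characters of R / N, and those are trivial on
    the derived subgroup. *)
Lemma norm_Res_rel_der1 T :
    N \subset T -> T \subset R -> (T / N \subset (R / N)^`(1))%g ->
  '['Res[T] (\sum_(i in rel) 'chi_i)] = '['Res[N] (\sum_(i in rel) 'chi_i)].
Proof.
move=> sNT sTR sTR'.
have RTi i : i \in rel ->
    'Res[T] 'chi_i = (\sum_r '['Res[R] 'chi_i, 'chi_r]) *: 'Res[T] 'chi_y.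
  rewrite 2!inE => /andP[ti p'i].
  rewrite -(cfResRes _ sTR sRH) {1}(cfun_sum_cfdot ('Res[R] 'chi_i)) linear_sum.
  rewrite scaler_suml; apply: eq_bigr => r _; rewrite linearZ /=.
  have [-> | ri] := eqVneq '['Res[R] 'chi_i, 'chi_r] 0; first by rewrite !scale0r.
  rewrite -irr_consttE in ri; congr (_ *: _).
  have tr : t \in irr_constt ('Res[N] 'chi_r).
    have RiN : 'Res[N] ('Res[R] 'chi_i) = '['Res[N] 'chi_i, 'chi_t] *: 'chi_t.
      rewrite cfResRes // {1}(Clifford_Res_sum_cfclass nsNH ti).
      by rewrite cfclass_invariant // big_seq1.
    have [j jr] := constt_cfRes_irr N r.
    have := constt_Res_trans (cfRes_char _ (irr_char i)) ri jr.
    by rewrite RiN => /constt_scale_irr <-.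
  have [b Db] := Gallagher_onto nsNR Ry tr.
  rewrite Db (cfRes_mulMod _ nsNR) // Res_lin_char_der1 ?cfMod_cfun1 ?mul1r //.
  (* b(1) is a power of p that divides the relative degree of chi_i *)
  have r1 : 'chi_r 1%g = 'chi_b 1%g * 'chi_t 1%g.
    by rewrite -(cfRes1 N) Db (cfRes_mulMod_ker nsNR Ry) cfunE.
  have [n Dn] := dvdn_constt_Res1_irr1 nsRH ri.
  have /natrP[d Dd] := Cnat_irr1 b.
  rewrite lin_irrE Dd pnatr_eq1 (@pnat_1 p d) //.
    have := dvd_irr1_cardG b; rewrite Dd dvdC_natr => dRN.
    exact: pnat_dvd dRN pRN.
  rewrite p'natE //; apply: contra p'i => /dvdnP[m Dm].
  rewrite Dn r1 mulrA mulfK ?irr1_neq0 // Dd Dm -natrM dvdC_natr.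
  by rewrite mulnA dvdn_mull.
have RTS : 'Res[T] (\sum_(i in rel) 'chi_i)
    = (\sum_(i in rel) \sum_r '['Res[R] 'chi_i, 'chi_r]) *: 'Res[T] 'chi_y.
  by rewrite linear_sum scaler_suml; apply: eq_bigr => i reli; apply: RTi.
have irr_yT : 'Res[T] 'chi_y \in irr T.
  apply: (cfRes_irr_irr (H := N)); first by rewrite cfRes_char ?irr_char.
  by rewrite cfResRes // Ry mem_irr.
have /irrP[x Dx] := irr_yT.
have Rx : 'Res[N] 'chi_x = 'chi_t by rewrite -Dx cfResRes.
rewrite Dx in RTS.
by rewrite (norm_extension Rx RTS sNT) cfResRes // (subset_trans sTR).
Qed.

(** Every extension of theta to R, that is, every product of chi_y with a linear
    character of R / N, lies under some character of relative p'-degree.  The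
    norm equality on T forces all of them to agree on T, so each linear
    character of R / N is trivial on T / N. *)
Lemma kernel_rel_der1 T :
    N \subset T -> T \subset R ->
    '['Res[T] (\sum_(i in rel) 'chi_i)] = '['Res[N] (\sum_(i in rel) 'chi_i)] ->
  (T / N \subset (R / N)^`(1))%g.
Proof.
set S := \sum_(i in _) _; move=> sNT sTR normT.
have sTH := subset_trans sTR sRH; have nsNT : N <| T := normalS sNT sTH nsNH.
have NS : S \is a character := sum_irr_char _.
have nzS : S != 0.
  have [i reli yi] := extension_rel_pprime Ry.
  apply: contraTneq (constt_sum_irr reli) => S0.
  by rewrite -/S S0 irr_consttE cfdot0l eqxx.
have [e RSN] := Res_sum_over nsNH It sub_rel_over.
have [||||x Rx DS] := @extension_of_norm _ T N t ('Res[T] S) e.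
- exact: cfRes_char.
- by rewrite cfRes_eq0.
- by rewrite cfResRes.
- by rewrite normT cfResRes.
have ext_x b : 'chi_b \is a linear_char ->
    'Res[T] (('chi[R / N]_b %% N)%CF * 'chi_y) = 'chi_x.
  move=> lin_b; have /irrP[z Dz] := Gallagher_irr nsNR Ry b; rewrite Dz.
  have Rz : 'Res[N] 'chi_z = 'chi_t.
    by rewrite -Dz (cfRes_mulMod_ker nsNR Ry) (lin_char1 lin_b) scale1r.
  have [i reli zi] := extension_rel_pprime Rz.
  have [j jz] := constt_cfRes_irr T z.
  have jS : j \in irr_constt ('Res[T] S).
    rewrite -(cfResRes _ sTR sRH); apply: (constt_Res_trans _ _ jz).
      exact: cfRes_char.
    exact: (constt_Res_trans NS (constt_sum_irr reli) zi).
  have irr_zT : 'Res[T] 'chi_z \in irr T.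
    apply: (cfRes_irr_irr (H := N)); first by rewrite cfRes_char ?irr_char.
    by rewrite cfResRes // Rz mem_irr.
  have /irrP[k Dk] := irr_zT; rewrite Dk.
  move: jz jS; rewrite Dk DS constt_irr inE => /eqP-> /constt_scale_irr -> //.
rewrite -cap_cfker_lin_irr; apply/bigcapsP=> b lin_b.
have lin1 : 'chi[R / N]_0 \is a linear_char by rewrite irr0 cfun1_lin_char.
have RyT : 'Res[T] 'chi_y = 'chi_x.
  by rewrite -(ext_x 0) // irr0 cfMod_cfun1 mul1r.
have irr_bT : 'Res[T / N] 'chi_b \in irr (T / N).
  by rewrite lin_char_irr ?cfRes_lin_char.
have /irrP[b' Db'] := irr_bT.
have b'0 : b' = 0.
  apply: (Gallagher_inj nsNT Rx); rewrite -Db' irr0 cfMod_cfun1 mul1r.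
  by rewrite -{1}RyT -(cfRes_mulMod _ nsNR) ?ext_x.
have sTk : (T / N)%g \subset cfker ('Res[T / N] 'chi_b).
  by rewrite Db' b'0 irr0 cfker_cfun1.
by apply: subset_trans sTk _; rewrite cfker_Res ?quotientS ?irr_char // subsetIr.
Qed.

End KernelLevels.

(** * Invariant extensions to the Sylow subgroup *)

Section InvariantExtension.

Variables (gT : finGroupType) (p : nat).
Implicit Types C G H K L M N P Q R T : {group gT}.
Variables (H N R : {group gT}) (t : Iirr N) (y : Iirr R).
Hypotheses (p_pr : prime p) (nsNH : N <| H) (nsRH : R <| H) (sNR : N \subset R).
Hypotheses (pRN : p.-group (R / N)%g) (p'HR : ~~ (p %| #|H : R|%g)%N).
Hypotheses (It : H \subset 'I['chi_t]) (Ry : 'Res[N] 'chi_y = 'chi_t).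

Let nsNR : N <| R. Proof. exact: normalS (normal_sub nsRH) nsNH. Qed.
Let eta := 'chi_y.
Let orbit_eta := (eta ^: H)%CF.
(** The linear characters of R / N that carry eta to its H-conjugates. *)
Let B := [set j : Iirr R | ('Res[N] 'chi_j == 1) && ('chi_j * eta \in orbit_eta)].

Let Res1_lin (j : Iirr R) : 'Res[N] 'chi_j = 1 -> 'chi_j \is a linear_char.
Proof. by move=> Rj; rewrite lin_irrE -(cfRes1 N) Rj cfun11. Qed.

Let Res1_mod (j : Iirr R) : 'Res[N] 'chi_j = 1 ->
  exists b : Iirr (R / N), 'chi_j = ('chi_b %% N)%CF.
Proof.
move=> Rj; exists (quo_Iirr N j); rewrite -mod_IirrE ?quo_IirrK //.
have : cfker ('Res[N] 'chi_j) = N by rewrite Rj cfker_cfun1.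
by rewrite cfker_Res ?irr_char // => <-; apply: subsetIr.
Qed.

Let inj_mul_eta : {in B &, injective (fun j => 'chi_j * eta)}.
Proof.
move=> j k; rewrite !inE => /andP[/eqP/Res1_mod[b Db] _] /andP[/eqP/Res1_mod[d Dd] _].
rewrite Db Dd => /(Gallagher_inj nsNR Ry) eq_bd.
by apply: irr_inj; rewrite -[LHS]/('chi_j) -[RHS]/('chi_k) Db Dd eq_bd.
Qed.

Let onto_mul_eta phi : phi \in orbit_eta -> exists2 j, j \in B & phi = 'chi_j * eta.
Proof.
move=> Ophi; have /cfclassP[h Hh Dphi] := Ophi.
have /irrP[i Di] : phi \in irr R by rewrite Dphi cfConjg_irr ?mem_irr.
have Ri : 'Res[N] 'chi_i = 'chi_t.
  by rewrite -Di Dphi -(cfConjgRes _ nsRH nsNH) // Ry (inertiaJ (subsetP It h Hh)).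
have ti : t \in irr_constt ('Res[N] 'chi_i) by rewrite Ri constt_irr inE.
have [b Db] := Gallagher_onto nsNR Ry ti.
exists (mod_Iirr b); last by rewrite mod_IirrE // -Db.
have lin_b : 'chi_b 1%g = 1.
  apply: (mulIf (irr1_neq0 t)); rewrite mul1r -[in RHS]Ri Db.
  by rewrite (cfRes_mulMod_ker nsNR Ry) cfunE.
rewrite inE mod_IirrE // -Db -Di Ophi andbT.
by rewrite cfRes_sub_ker ?cfker_mod // cfMod1 lin_b scale1r.
Qed.

Let card_B : #|B| = #|H : 'I_H[eta]|%g.
Proof.
rewrite -(card_cfclass_Iirr y nsRH).
have <- : [set cfIirr ('chi_j * eta) | j in B] = cfclass_Iirr H y.
  apply/setP=> i; rewrite cfclass_IirrE; apply/imsetP/idP => [[j Bj ->] | Oi].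
    have := Bj; rewrite inE => /andP[/eqP/Res1_mod[b Db] Oj].
    by rewrite cfIirrE // Db (Gallagher_irr nsNR Ry).
  by have [j Bj Dj] := onto_mul_eta Oi; exists j => //; rewrite -Dj irrK.
apply/esym/card_in_imset => j k Bj Bk /(congr1 (fun i => 'chi_i)).
have irrB i : i \in B -> 'chi_i * eta \in irr R.
  rewrite inE => /andP[/eqP/Res1_mod[b ->] _]; exact: Gallagher_irr nsNR Ry b.
by rewrite !cfIirrE ?irrB //; apply: inj_mul_eta.
Qed.

(** Let mu be the product of the linear characters in B and r = |B|, which divides
    |H : R| and so is prime to p.  If h in H carries eta to c eta, then it maps
    b in B to b^h c in B, so that mu = mu^h c^r.  With r s = 1 modulo |R / N|,
    this says that mu^s eta is fixed by h: averaging over the orbit of eta. *)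
Theorem invariant_extension :
  exists2 z : Iirr R, 'Res[N] 'chi_z = 'chi_t & H \subset 'I['chi_z].
Proof.
have lin_B j : j \in B -> 'chi_j \is a linear_char.
  by rewrite inE => /andP[/eqP/Res1_lin].
pose mu := \prod_(j in B) 'chi_j.
have lin_mu : mu \is a linear_char by apply: rpred_prod.
have Rmu : 'Res[N] mu = 1.
  rewrite rmorph_prod big1 //= => j; rewrite inE => /andP[/eqP//].
pose n := #|R / N|%g; pose r := #|B|; pose s := (r ^ (totient n).-1)%N.
have co_rn : coprime r n.
  rewrite coprime_sym (pnat_coprime pRN) // p'natE // /r card_B.
  apply: contra p'HR => /dvdn_trans; apply; apply: indexgS.
  by rewrite subsetI normal_sub ?sub_inertia.
have rs1 : (r * s = 1 %[mod n])%N.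
  rewrite -expnS prednK ?totient_gt0 ?cardG_gt0 //; exact: Euler_exp_totient.
have mu_act h : h \in H -> exists2 c, c \in B &
    (eta ^ h)%CF = 'chi_c * eta /\ mu = (mu ^ h)%CF * 'chi_c ^+ r.
  move=> Hh; have [|c Bc Dc] := @onto_mul_eta (eta ^ h)%CF.
    by apply/cfclassP; exists h.
  exists c => //; split=> //.
  pose g j := cfIirr (('chi_j ^ h)%CF * 'chi_c).
  have gE j : j \in B -> 'chi_(g j) = ('chi_j ^ h)%CF * 'chi_c.
    move=> Bj; rewrite cfIirrE // lin_char_irr // rpredM ?lin_B //.
    by rewrite cfConjg_lin_char ?lin_B.
  have injg : {in B &, injective g}.
    move=> j k Bj Bk /(congr1 (fun i => 'chi_i)); rewrite !gE //.
    move/(mulIr (lin_char_unitr (lin_B c Bc))); rewrite -!conjg_IirrE.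
    by move/irr_inj/conjg_Iirr_inj.
  have gB : g @: B = B.
    apply/eqP; rewrite eqEcard card_in_imset // leqnn andbT.
    apply/subsetP=> _ /imsetP[j Bj ->]; rewrite inE gE // -mulrA -Dc -rmorphM.
    have := Bj; have := Bc; rewrite !inE => /andP[/eqP Rc _] /andP[/eqP Rj Oj].
    rewrite [X in X == _]rmorphM /= Rc mulr1 -(cfConjgRes _ nsRH nsNH) // Rj.
    rewrite cfConjg_cfun1 eqxx /=.
    have /cfclassP[k Hk ->] := Oj; rewrite -(cfConjgM _ nsRH) //.
    by apply/cfclassP; exists (k * h)%g; rewrite ?groupM.
  rewrite {1}/mu -gB big_imset //= (eq_bigr _ gE) big_split /= prodr_const.
  by rewrite rmorph_prod.
have irr_z : mu ^+ s * eta \in irr R by rewrite mul_lin_irr ?rpredX ?mem_irr.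
have /irrP[z Dz] := irr_z; exists z; rewrite -Dz.
  by rewrite rmorphM rmorphXn /= Rmu expr1n mul1r.
apply/subsetP=> h Hh; rewrite inE (subsetP (normal_norm nsRH)) //=.
have [c Bc [Dc Dmu]] := mu_act h Hh; apply/eqP.
rewrite rmorphM rmorphXn /= Dc mulrA {2}Dmu exprMn -exprM.
suffices -> : 'chi_c ^+ (r * s) = 'chi_c by [].
have [b Db] : exists b : Iirr (R / N), 'chi_c = ('chi_b %% N)%CF.
  by apply: Res1_mod; move: Bc; rewrite inE => /andP[/eqP].
have lin_b : 'chi_b \is a linear_char by rewrite -(cfMod_lin_charE _ nsNR) -Db lin_B.
rewrite Db -rmorphXn /=; congr (_ %% N)%CF.
have bn : 'chi_b ^+ n = 1 by apply/eqP; rewrite -dvdn_cforder cforder_lin_char_dvdG.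
by rewrite -(expr_mod _ bn) rs1 expr_mod // expr1.
Qed.

End InvariantExtension.

(** * Characters of a group with a normal complement *)

Section Complements.

Variables (gT : finGroupType) (p : nat).
Implicit Types C G H K L M N P Q R T : {group gT}.

(** An invariant character induced from a normal subgroup vanishes outside it and
    is multiplied by the index on it; here the two indices agree and H meets K
    in N. *)
Lemma Res_Ind_complement G H K N (t : Iirr N) (k : Iirr K) :
    N <| H -> K <| G -> H \subset G -> (K * H)%g = G -> K :&: H = N ->
    H \subset 'I['chi_t] -> G \subset 'I['chi_k] -> 'Res[N] 'chi_k = 'chi_t ->
  'Res[H] ('Ind[G] 'chi_k) = 'Ind[H] 'chi_t.
Proof.
move=> nsNH nsKG sHG GE KHN It Ik Rk.
have sNH := normal_sub nsNH; have sKG := normal_sub nsKG.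
have sNK : N \subset K by rewrite -KHN subsetIl.
have iKG : #|G : K|%g = #|H : N|%g.
  apply/eqP; rewrite -(eqn_pmul2l (cardG_gt0 K)) Lagrange // -GE -(eqn_pmul2r (cardG_gt0 N)).
  by rewrite -{1}KHN -mul_cardG -mulnA [(#|H : N|%g * _)%N]mulnC Lagrange.
apply/cfun_inP=> x Hx; rewrite cfResE //.
have [Nx | notNx] := boolP (x \in N); last first.
  rewrite (cfun_on0 (cfInd_normal _ nsKG)) ?(cfun_on0 (cfInd_normal _ nsNH)) //.
  by apply: contra notNx => Kx; rewrite -KHN inE Kx.
have Kx := subsetP sNK x Nx.
transitivity ('Res[K] ('Ind[G] 'chi_k) x); first by rewrite cfResE.
rewrite cfRes_Ind_invariant // cfunE -(cfResE 'chi_k sNK Nx) Rk.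
transitivity ('Res[N] ('Ind[H] 'chi_t) x); last by rewrite cfResE.
by rewrite cfRes_Ind_invariant // cfunE iKG.
Qed.

(** Let e be the multiplicity of theta in psi = chi_i.  By the previous lemma e is
    the inner product of psi^G with k^G, so a common constituent c restricts to K
    as f k with 0 < f <= e.  Then c(1) = f theta(1) <= e theta(1) = psi(1),
    while psi is a constituent of the restriction of c to H. *)
Lemma extension_from_complement G H K N (t : Iirr N) (k : Iirr K) (i : Iirr H) :
    N <| H -> K <| G -> H \subset G -> (K * H)%g = G -> K :&: H = N ->
    H \subset 'I['chi_t] -> G \subset 'I['chi_k] -> 'Res[N] 'chi_k = 'chi_t ->
    t \in irr_constt ('Res[N] 'chi_i) ->
  exists c : Iirr G, 'Res[H] 'chi_c = 'chi_i.
Proof.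
move=> nsNH nsKG sHG GE KHN It Ik Rk ti.
pose e := '['Res[N] 'chi_i, 'chi_t].
pose m c := '['Ind[G] 'chi_i, 'chi_c]; pose f (c : Iirr G) := '['Res[K] 'chi_c, 'chi_k].
have Nm c : m c \in Num.nat by rewrite Cnat_cfdot_char_irr ?cfInd_char ?irr_char.
have Nf c : f c \in Num.nat by rewrite Cnat_cfdot_char_irr ?cfRes_char ?irr_char.
have De : e = \sum_c m c * f c.
  rewrite /e cfdot_Res_l -(Res_Ind_complement nsNH nsKG sHG GE KHN It Ik Rk).
  rewrite cfdot_Res_r (cfun_sum_cfdot ('Ind[G] 'chi_i)) cfdot_suml.
  by apply: eq_bigr => c _; rewrite cfdotZl -cfdot_Res_l.
have [c nz_mf] : exists c, m c * f c != 0.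
  apply/existsP; apply: contraTT ti => /existsPn all0.
  rewrite irr_consttE negbK -/e De big1 // => c _; apply/eqP.
  by have := all0 c; rewrite negbK.
exists c; have [nz_m nz_f] : m c != 0 /\ f c != 0 by apply/norP; rewrite -mulf_eq0.
have fe : f c <= e.
  have mf_ge0 d : 0 <= m d * f d by rewrite natr_ge0 // rpredM.
  apply: (@le_trans _ _ (m c * f c)).
    have /natrP[a Da] := Nm c; rewrite ler_peMl ?natr_ge0 // Da ler1n lt0n.
    by rewrite -(eqr_nat algC) -Da.
  by rewrite De (bigD1 c) //= lerDl sumr_ge0.
have Rc : 'Res[K] 'chi_c = f c *: 'chi_k.
  rewrite {1}(Clifford_Res_sum_cfclass nsKG (_ : k \in _)) ?irr_consttE //.
  by rewrite cfclass_invariant // big_seq1.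
have i1 : 'chi_i 1%g = e * 'chi_t 1%g.
  rewrite -(cfRes1 N) {1}(Clifford_Res_sum_cfclass nsNH ti).
  by rewrite cfclass_invariant // big_seq1 cfunE.
have c1 : 'chi_c 1%g = f c * 'chi_t 1%g.
  by rewrite -(cfRes1 K) Rc cfunE -Rk cfRes1.
have : i \in irr_constt ('Res[H] 'chi_c) by rewrite -constt_Ind_Res irr_consttE.
case/constt_charP=> [|phi Nphi Dphi]; first by rewrite cfRes_char ?irr_char.
suffices /eqP phi0 : phi == 0 by rewrite Dphi phi0 addr0.
rewrite -char1_eq0 // eq_le char1_ge0 // andbT.
rewrite -(lerD2l ('chi_i 1%g)) addr0.
have : ('chi_i + phi) 1%g = 'chi_c 1%g by rewrite -Dphi cfRes1.
by rewrite cfunE => ->; rewrite c1 i1 ler_pM2r ?irr1_gt0.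
Qed.

(** Let D be the kernel of l.  Invariance gives [K, P] <= D, so K normalizes DP,
    and the Frattini argument yields K <= D P N(P).  The part in N(P) can be
    chosen in K n N(P), which lies in N, hence in D. *)
Lemma invariant_lin_char_trivial G N P K (l : 'CF(K)) :
    p.-Sylow(G) P -> K <| G -> N \subset K -> K :&: (N * 'N_G(P))%g = N ->
    l \is a linear_char -> N \subset cfker l -> P \subset 'I[l] ->
  l = 1.
Proof.
move=> sylP nsKG sNK KN lin_l Nl Il; have [sKG nKG] := andP nsKG.
have sPG := pHall_sub sylP; have nKP := subset_trans sPG nKG.
pose D := cfker_group l; have sDK : D \subset K := cfker_sub l.
have nDP : P \subset 'N(D).
  apply/subsetP=> x Px; have nKx := subsetP nKP x Px.
  by rewrite inE /= -cfker_conjg // (inertiaJ (subsetP Il x Px)).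
have comm_D x y : x \in K -> y \in P -> [~ x, y]%g \in D.
  move=> Kx Py; have Ky : y \in 'N(K) := subsetP nKP y Py.
  have Kxy : (x ^ y)%g \in K by rewrite memJ_norm.
  rewrite /= cfkerEchar ?lin_charW // inE groupM ?groupV //=.
  rewrite commgEl lin_charM ?groupV // lin_charV //.
  rewrite (inertia_valJ x (subsetP Il y Py)) mulVf ?lin_char_neq0 //.
  by rewrite (lin_char1 lin_l).
pose DP := (D <*> P)%G.
have sDDP : D \subset DP := joing_subl D P.
have sPDP : P \subset DP := joing_subr D P.
have nDPK : K \subset 'N(DP).
  have nDK : K \subset 'N(D) := cfker_norm l.
  apply/subsetP=> x Kx; rewrite inE -genJ gen_subG conjUg subUset.
  rewrite (normP (subsetP nDK x Kx)) joing_subl /=.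
  apply/subsetP=> _ /imsetP[y Py ->].
  rewrite conjg_mulR -/(gval DP) groupM //; first exact: (subsetP sPDP).
  by rewrite (subsetP sDDP) // -invgR groupV comm_D.
suffices sKD : K \subset D.
  by rewrite -(cfRes_id l) cfRes_sub_ker // (lin_char1 lin_l) scale1r.
apply/subsetP=> x Kx.
have sylDP : p.-Sylow(DP <*> K) P.
  apply: pHall_subl sylP; last by rewrite !join_subG sPG sKG (subset_trans sDK).
  by rewrite (subset_trans (joing_subr _ _) (joing_subl _ _)).
have nsDP : DP <| DP <*> K by rewrite normalYl.
have sylP' : p.-Sylow(DP) P by apply: pHall_subl sylDP; rewrite ?joing_subr ?joing_subl.
have /= DPE := Frattini_arg nsDP sylP'.
have : x \in DP <*> K by rewrite (subsetP (joing_subr _ _)).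
rewrite -DPE => /mulsgP[w y DPw Ny Dx].
have := DPw; rewrite /= norm_joinEr // => /mulsgP[d z Dd Pz Dw].
rewrite {w DPw}Dw in Dx.
have Gy : y \in G.
  apply: subsetP Ny; rewrite subIset // !join_subG sPG sKG (subset_trans sDK) //.
suffices Nzy : (z * y)%g \in N by rewrite Dx -mulgA groupM // (subsetP Nl).
rewrite -KN inE; apply/andP; split.
  by rewrite -(groupMl _ (subsetP sDK d Dd)) mulgA -Dx.
rewrite -[(z * y)%g]mul1g mem_mulg // groupM // inE.
  by rewrite (subsetP sPG) // (subsetP (normG P)).
by rewrite Gy; case/setIP: Ny.
Qed.

Lemma card_extensions K N (t : Iirr N) (k0 : Iirr K) :
    N <| K -> 'Res[N] 'chi_k0 = 'chi_t ->
  #|[set k : Iirr K | 'Res[N] 'chi_k == 'chi_t]| = #|(K / N) : (K / N)^`(1)|%g.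
Proof.
move=> nsNK Rk0; pose g (b : Iirr (K / N)) := cfIirr (('chi_b %% N)%CF * 'chi_k0).
have gE b : 'chi_(g b) = ('chi_b %% N)%CF * 'chi_k0.
  by rewrite cfIirrE // (Gallagher_irr nsNK Rk0).
have injg : injective g.
  move=> b b' /(congr1 (fun k => 'chi_k)); rewrite !gE.
  exact: (Gallagher_inj nsNK Rk0).
have Rg b : 'Res[N] 'chi_(g b) = 'chi_b 1%g *: 'chi_t.
  by rewrite gE (cfRes_mulMod_ker nsNK Rk0).
rewrite -card_lin_irr -(card_imset _ injg); congr #|pred_of_set _|.
apply/setP=> k; rewrite inE; apply/eqP/imsetP=> [Rk | [b lin_b ->]]; last first.
  by rewrite Rg (lin_char1 lin_b) scale1r.
have tk : t \in irr_constt ('Res[N] 'chi_k) by rewrite Rk constt_irr inE.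
have [b Db] := Gallagher_onto nsNK Rk0 tk.
have gb : g b = k by apply: irr_inj; rewrite -[LHS]/('chi__) -[RHS]/('chi__) gE Db.
exists b => //; rewrite inE lin_irrE; have := Rg b; rewrite gb Rk.
rewrite -{1}['chi_t]scale1r => /eqP; rewrite eq_scaled_irr eqxx oner_eq0 /= andbT.
by rewrite eq_sym.
Qed.

(** P fixes an extension k because their number, |K / N : (K / N)'|, is prime to p.
    For g in N_G(P), k^g is again fixed by P, so it is the product of k with a
    P-invariant linear character of K / N; the latter is trivial. *)
Theorem complement_invariant_extension G N P K (t : Iirr N) (k0 : Iirr K) :
    prime p -> p.-Sylow(G) P -> N <| G -> K <| G -> N \subset K ->
    (K * 'N_G(P))%g = G -> K :&: (N * 'N_G(P))%g = N ->
    G \subset 'I['chi_t] -> 'Res[N] 'chi_k0 = 'chi_t ->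
  exists2 k : Iirr K, 'Res[N] 'chi_k = 'chi_t & G \subset 'I['chi_k].
Proof.
move=> p_pr sylP nsNG nsKG sNK GE KN It Rk0; have [sKG nKG] := andP nsKG.
have nsNK : N <| K := normalS sNK sKG nsNG.
have [sPG pP _] := and3P sylP; have nKP := subset_trans sPG nKG.
have sKP_N : K :&: P \subset N.
  rewrite -KN setIS //; apply: subset_trans (mulG_subr _ _).
  by rewrite subsetI sPG normG.
(* K n P <= N is a Sylow subgroup of K *)
have p'KN : ~~ (p %| #|K : N|%g)%N.
  have /and3P[sKPK _] := Sylow_setI_normal nsKG sylP.
  rewrite p'natE //; apply: contra => /dvdn_trans; apply; exact: indexgS.
pose f (k : Iirr K) := nat_of_bool ('Res[N] 'chi_k == 'chi_t).
have Res_act (k : Iirr K) y : y \in G ->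
    'Res[N] 'chi_k = 'chi_t -> 'Res[N] ('chi_k ^ y)%CF = 'chi_t.
  move=> Gy Rk; rewrite -(cfConjgRes _ nsKG nsNG) // Rk.
  exact: inertiaJ (subsetP It y Gy).
have fP k y : y \in P -> f (conjg_Iirr k y) = f k.
  move=> Py; have Gy := subsetP sPG y Py; congr nat_of_bool; rewrite conjg_IirrE.
  apply/eqP/eqP=> [Rky | /Res_act-> //].
  have := Res_act (conjg_Iirr k y) y^-1%g; rewrite conjg_IirrE cfConjgK.
  by apply; rewrite ?groupV.
have [|k Ik] := pgroup_invariant_irr pP nKP fP.
  have -> : (\sum_k f k)%N = #|[set k : Iirr K | 'Res[N] 'chi_k == 'chi_t]|.
    rewrite -sum1_card [in RHS]big_mkcond /=; apply: eq_bigr => k _.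
    by rewrite inE /f; case: eqP.
  rewrite (card_extensions nsNK Rk0); apply: contra p'KN => /dvdn_trans; apply.
  by rewrite -card_quotient ?normal_norm // dvdn_indexg.
rewrite /f; case: eqP => [Rk _ | _]; last by rewrite dvdn0.
exists k => //; rewrite -{1}GE; apply/subsetP=> _ /mulsgP[z g Kz Ng ->].
apply: groupM; first exact: (subsetP (sub_inertia _)).
have [Gg nPg] := setIP Ng; have nKg := subsetP nKG g Gg.
have Rkg : 'Res[N] 'chi_(conjg_Iirr k g) = 'chi_t by rewrite conjg_IirrE Res_act.
have tkg : t \in irr_constt ('Res[N] 'chi_(conjg_Iirr k g)).
  by rewrite Rkg constt_irr inE.
have [b Db] := Gallagher_onto nsNK Rk tkg.
have lin_b : 'chi_b \is a linear_char.
  rewrite lin_irrE; have := Rkg; rewrite Db (cfRes_mulMod_ker nsNK Rk).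
  rewrite -[X in _ = X]scale1r => /eqP; rewrite eq_scaled_irr.
  by case/andP.
pose l := ('chi_b %% N)%CF; have lin_l : l \is a linear_char by apply: cfMod_lin_char.
suffices l1 : l = 1.
  by rewrite /= inE nKg -conjg_IirrE Db -/l l1 mul1r eqxx.
apply: (invariant_lin_char_trivial sylP nsKG sNK KN lin_l); first exact: cfker_mod.
apply/subsetP=> x Px; have nKx := subsetP nKP x Px; have Gx := subsetP sPG x Px.
have Pgx : (x ^ g^-1)%g \in P by rewrite memJ_norm ?groupV.
(* g normalizes P, so k^g is again P-invariant *)
have kgx : (('chi_k ^ g) ^ x)%CF = ('chi_k ^ g)%CF.
  rewrite -(cfConjgM _ nsKG) // -[(g * x)%g](mulgKV g).
  have -> : (g * x * g^-1 = x ^ g^-1)%g by rewrite conjgE invgK mulgA.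
  rewrite (cfConjgM _ nsKG) ?(subsetP sPG (x ^ g^-1)%g) //.
  by rewrite (inertiaJ (subsetP Ik _ Pgx)).
(* cancel the invariant factors k and k^g *)
have lx : (l ^ x)%CF * 'chi_k = l * 'chi_k.
  rewrite -[in LHS](inertiaJ (subsetP Ik x Px)) -rmorphM /l -Db conjg_IirrE.
  by rewrite /= kgx.
rewrite inE nKx; apply/eqP.
have [d Dd] : exists d : Iirr (K / N), (l ^ x)%CF = ('chi_d %% N)%CF.
  exists (conjg_Iirr b (coset N x)); rewrite conjg_IirrE.
  by rewrite -(cfConjgMod _ nsKG nsNG).
by rewrite Dd (Gallagher_inj nsNK Rk (b := d) (b' := b)) // -Dd.
Qed.

End Complements.

(** * Equivalence of the four conditions *)

Section Equivalence.

Variables (gT : finGroupType) (p : nat).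
Implicit Types C G H K L M N P Q R T : {group gT}.

Lemma normal_complementP G N P K :
    N <| G -> normal_complement G N P K ->
  [/\ N \subset K, K <| G, (K * 'N_G(P))%g = G & K :&: (N * 'N_G(P))%g = N].
Proof.
move=> nsNG [sNK sKG nsKNG GE KN]; split=> //.
have nsNK : N <| K := normalS sNK sKG nsNG.
by rewrite -(quotientGK nsNG) -(quotientGK nsNK) cosetpre_normal.
Qed.

Lemma normal_Sylow_normalizer G N P :
    N <| G -> p.-Sylow(G) P ->
  [/\ N <| N <*> 'N_G(P), N <*> 'N_G(P) \subset G,
      N <*> 'N_G(P) = (N * 'N_G(P))%g & N <*> P <| N <*> 'N_G(P)].
Proof.
move=> nsNG sylP; have [sNG nNG] := andP nsNG; have sPG := pHall_sub sylP.
have nNNP : 'N_G(P) \subset 'N(N) by rewrite subIset ?nNG.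
have nNP : P \subset 'N(N) := subset_trans sPG nNG.
have sPNP : P \subset 'N_G(P) by rewrite subsetI sPG normG.
split; rewrite ?normalYl ?norm_joinEr ?mul_subG ?subsetIl //.
rewrite -!norm_joinEr // /normal genS ?setUS //= join_subG.
by rewrite (subset_trans (joing_subl N P) (normG _)) normsY // subsetIr.
Qed.

Theorem extends_of_complement G N P (t : Iirr N) :
    N <| G -> p.-Sylow(G) P -> G \subset 'I['chi_t] ->
    (exists K : {group gT}, normal_complement G N P K /\
      exists2 k : Iirr K, 'Res[N] 'chi_k = 'chi_t & G \subset 'I['chi_k]) ->
  forall i, i \in irr_over (N <*> 'N_G(P)) t -> char_extends G 'chi_i.
Proof.
move=> nsNG sylP It [K [/(normal_complementP nsNG)[sNK nsKG GE KN] [k Rk Ik]]] i.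
rewrite inE => ti; have [nsNH sHG HE nsRH] := normal_Sylow_normalizer nsNG sylP.
have [|||c Rc] := extension_from_complement nsNH nsKG sHG _ _ _ Ik Rk ti.
- by rewrite /= HE mulgA (mulGSid sNK).
- by rewrite /= HE.
- exact: subset_trans sHG It.
by split=> //; exists 'chi_c; rewrite ?irr_char.
Qed.

Theorem complement_of_extends G N P (t : Iirr N) :
    prime p -> N <| G -> G \subset 'I['chi_t] -> p.-Sylow(G) P ->
    char_extends (N <*> P) 'chi_t ->
    (forall i, i \in irr_rel_pprime p (N <*> 'N_G(P)) t -> char_extends G 'chi_i) ->
  exists K : {group gT}, normal_complement G N P K /\
    exists k : Iirr K, 'Res[N] 'chi_k = 'chi_t.
Proof.
move=> p_pr nsNG It sylP [_ [eta Neta Reta]] ext.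
have [sNG nNG] := andP nsNG; have [sPG pP _] := and3P sylP.
have [nsNH sHG HE nsRH] := normal_Sylow_normalizer nsNG sylP.
pose H := (N <*> 'N_G(P))%G; pose R := (N <*> P)%G.
rewrite -/(gval H) in ext nsNH sHG HE nsRH; rewrite -/(gval R) in nsRH.
have sNH := normal_sub nsNH; have sRH := normal_sub nsRH.
have sNR : N \subset R := joing_subl N P; have sPR : P \subset R := joing_subr N P.
have nsNR : N <| R := normalS sNR sRH nsNH.
have nNP := subset_trans sPG nNG.
have RbE : (R / N = P / N)%g by rewrite quotientYidl.
have pRN : p.-group (R / N)%g by rewrite RbE quotient_pgroup.
have p'HR : ~~ (p %| #|H : R|%g)%N.
  have sylPH : p.-Sylow(H) P := pHall_subl (subset_trans sPR sRH) sHG sylP.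
  have /and3P[_ _] := sylPH; rewrite p'natE //; apply: contra => /dvdn_trans.
  by apply; apply: indexgS.
have ItH := subset_trans sHG It.
have [y0 Ry0] : exists y0 : Iirr R, 'Res[N] 'chi_y0 = 'chi_t.
  have /irrP[y0 Dy0] : eta \in irr R.
    by apply: (cfRes_irr_irr (H := N)) => //; rewrite Reta mem_irr.
  by exists y0; rewrite -Dy0.
have [y Ry Iy] := invariant_extension p_pr nsNH nsRH sNR pRN p'HR ItH Ry0.
pose rel := irr_rel_pprime p H t.
have /fin_all_exists[Psi PsiP] : forall i : Iirr H, exists psi : 'CF(G),
    i \in rel -> psi \is a character /\ 'Res[H] psi = 'chi_i.
  move=> i; have [/ext[_ [psi Npsi Rpsi]] | _] := boolP (i \in rel); last by exists 0.
  by exists psi.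
(* the relative kernels of sums of extensions, described by their traces on H *)
have kernel (A : {set Iirr H}) : A \subset rel -> exists2 L : {group gT},
    [/\ N \subset L, L <| G & exists2 S : 'CF(G), S \is a character
         & 'Res[H] S = \sum_(i in A) 'chi_i /\ '['Res[L] S] = '['Res[N] S]]
  & forall T, N \subset T -> T \subset H -> (T \subset L) =
      ('['Res[T] (\sum_(i in A) 'chi_i)] == '['Res[N] (\sum_(i in A) 'chi_i)]).
  move=> sA; pose S := \sum_(i in A) Psi i.
  have NS : S \is a character.
    by apply: rpred_sum => i /(subsetP sA)/PsiP[].
  have RS : 'Res[H] S = \sum_(i in A) 'chi_i.
    by rewrite linear_sum; apply: eq_bigr => i /(subsetP sA)/PsiP[].
  have [L [sNL nsLG] LP] := relative_kernel nsNG NS.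
  exists L => [|T sNT sTH].
    split=> //; exists S => //; split=> //.
    by apply/eqP; rewrite -LP // normal_sub.
  by rewrite LP ?(subset_trans sTH) // -RS !cfResRes.
pose rely := [set i in rel | i \in irr_over H y].
have sub_rely : rely \subset rel by apply/subsetP=> i; rewrite inE => /andP[].
(* L n H = R, from the characters over the invariant extension of theta *)
have [L [sNL nsLG [S NS [RS normL]]] LP] := kernel rely sub_rely.
(* K n R is the inverse image of D = (R / N)' *)
have [K [sNK nsKG _] KP] := kernel rel (subxx _).
have sRL : R \subset L.
  rewrite LP //; apply/eqP; apply: (norm_Res_irr_over nsRH sNR Ry Iy).
  by apply/subsetP=> i; rewrite inE => /andP[].
have sLHR : L :&: H \subset R.
  have sRLH : R \subset L :&: H by rewrite subsetI sRL.
  apply: (kernel_rel_over_sub nsNH nsRH sNR p'HR ItH Ry Iy sRLH).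
    exact: subsetIr.
  by apply/eqP; rewrite -LP ?subsetIl ?subsetIr // (subset_trans sNR).
have sub_RH T : T \subset R -> T \subset H by move/subset_trans; apply.
pose M := (L :&: K)%G; pose D := (R / N)^`(1)%g.
have nsMG : M <| G := normalI nsLG nsKG.
have sNM : N \subset M by rewrite subsetI sNL.
have sDM : D \subset (M / N)%g.
  pose T := (coset N @*^-1 D)%G.
  have sDR : D \subset (R / N)%g := der_sub 1 _.
  have sNT : N \subset T := sub_cosetpre _.
  have sTR : T \subset R by rewrite -(quotientGK nsNR) morphpreS.
  have TN : (T / N)%g = D by rewrite cosetpreK.
  rewrite -TN quotientS // subsetI (subset_trans sTR sRL) KP ?sub_RH //.
  by apply/eqP; apply: (norm_Res_rel_der1 p_pr nsNH nsRH sNR pRN ItH Ry); rewrite ?TN.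
have sMD : (M / N :&: R / N)%g \subset D.
  rewrite -(quotientGI _ sNM); apply: (kernel_rel_der1 nsNH nsRH sNR p'HR ItH Ry).
  - by rewrite subsetI sNM.
  - exact: subsetIr.
  have sNMR : N \subset (M :&: R)%G by rewrite subsetI sNM.
  have sMRH : (M :&: R)%G \subset H by rewrite sub_RH ?subsetIr.
  by apply/eqP; rewrite -(KP _ sNMR sMRH) /= subIset // subsetIr.
have HbE : (H / N = 'N_(G / N)(P / N))%g.
  by rewrite (quotient_norm_Sylow nsNG sylP) quotientYidl // subIset ?nNG.
have [||||||||Xb [nsXG sXL XG XH]] :=
  @normalizer_complement _ p (G / N) (L / N) (M / N) (P / N) p_pr.
- exact: quotient_pHall.
- exact: quotient_normal.
- exact: quotient_normal.
- by rewrite quotientS ?subsetIl.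
- by rewrite quotientS // (subset_trans sPR).
- have sLGb : (L / N \subset G / N)%g by rewrite quotientS ?normal_sub.
  rewrite /= -(setIidPl sLGb) -setIA -HbE -quotientGI // -RbE quotientS //.
- by rewrite /= -RbE; apply: sDM.
- by rewrite /= -RbE; apply: sMD.
(* the complement lies in L, where theta extends *)
pose X := (coset N @*^-1 Xb)%G.
have sNX : N \subset X := sub_cosetpre _.
have XN : (X / N)%g = Xb by rewrite cosetpreK.
have nsXG' : X <| G by rewrite -(quotientGK nsNG) cosetpre_normal.
have sXL' : X \subset L.
  by rewrite -(quotientGK (normalS sNL (normal_sub nsLG) nsNG)) morphpreS.
exists X; split.
  split; rewrite ?XN // ?(normal_sub nsXG') //.
    apply/eqP; rewrite eqEsubset mul_subG ?(normal_sub nsXG') ?subsetIl //=.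
    rewrite -(mulSGid sNX) -mulgA -quotientSK // quotientMl; last first.
      exact: subset_trans (normal_sub nsXG') nNG.
    by rewrite XN -(quotient_norm_Sylow nsNG sylP) XG.
  rewrite -HE; apply/eqP; rewrite eqEsubset subsetI sNX sNH !andbT.
  rewrite -quotient_sub1; last by apply: subset_trans nNG; rewrite subIset ?(normal_sub nsXG').
  by rewrite quotientGI // XN HbE XH.
pose sum_rely := \sum_(i in rely) 'chi_i.
have [e RNe] : exists e, 'Res[N] sum_rely = e *: 'chi_t.
  apply: Res_sum_over nsNH ItH _; apply: subset_trans sub_rely _.
  by apply/subsetP=> i; rewrite inE => /andP[].
have RNS : 'Res[N] S = e *: 'chi_t by rewrite -(cfResRes _ sNH sHG) RS.
have nzS : S != 0.
  have [i reli yi] := extension_rel_pprime nsRH sNR p'HR Ry.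
  rewrite -(cfRes_eq0 H) // RS.
  have : i \in rely by rewrite inE reli inE.
  move/constt_sum_irr; apply: contraTneq => S0.
  by rewrite S0 irr_consttE cfdot0l eqxx.
have [||||x Rx _] := @extension_of_norm _ L N t ('Res[L] S) e.
- exact: cfRes_char.
- by rewrite cfRes_eq0.
- by rewrite cfResRes ?(normal_sub nsLG).
- by rewrite normL cfResRes ?(normal_sub nsLG).
have /irrP[k Dk] : 'Res[X] 'chi_x \in irr X.
  apply: (cfRes_irr_irr (H := N)); first by rewrite cfRes_char ?irr_char.
  by rewrite cfResRes // Rx mem_irr.
by exists k; rewrite -Dk cfResRes.
Qed.

End Equivalence.

Theorem theorem2p6 (gT : finGroupType) (G N P : {group gT}) (p : nat)
    (t : Iirr N) :
  prime p -> N <| G -> G \subset 'I['chi_t] -> p.-Sylow(G) P ->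
  char_extends (N <*> P) 'chi_t ->
  [<-> forall i, i \in irr_rel_pprime p (N <*> 'N_G(P)) t ->
         char_extends G 'chi_i;
       forall i, i \in irr_over (N <*> 'N_G(P)) t -> char_extends G 'chi_i;
       exists K : {group gT}, normal_complement G N P K /\
         exists k : Iirr K, 'Res[N] 'chi_k = 'chi_t;
       exists K : {group gT}, normal_complement G N P K /\
         exists2 k : Iirr K, 'Res[N] 'chi_k = 'chi_t & G \subset 'I['chi_k]].
Proof.
move=> p_pr nsNG It sylP extP.
have all_to_rel : (forall i, i \in irr_over (N <*> 'N_G(P)) t -> char_extends G 'chi_i) ->
    forall i, i \in irr_rel_pprime p (N <*> 'N_G(P)) t -> char_extends G 'chi_i.
  by move=> ext i; rewrite inE => /andP[/ext].
have rel_to_compl := complement_of_extends p_pr nsNG It sylP extP.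
have invariant_to_all := extends_of_complement nsNG sylP It.
have to_invariant : (exists K : {group gT}, normal_complement G N P K /\
      exists k : Iirr K, 'Res[N] 'chi_k = 'chi_t) ->
    exists K : {group gT}, normal_complement G N P K /\
      exists2 k : Iirr K, 'Res[N] 'chi_k = 'chi_t & G \subset 'I['chi_k].
  case=> K [complK [k0 Rk0]]; exists K; split=> //.
  have [sNK nsKG GE KN] := normal_complementP nsNG complK.
  exact: complement_invariant_extension p_pr sylP nsNG nsKG sNK GE KN It Rk0.
tfae.
- by move/rel_to_compl/to_invariant/invariant_to_all.
- by move/all_to_rel/rel_to_compl.
- exact: to_invariant.
by move/invariant_to_all/all_to_rel.
Qed.
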